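(* Let $E(q)=\prod_{k\ge1}(1-q^k)$, $$X=\frac{E(q^2)^4E(q^3)^8}{E(q)^8E(q^6)^4},\qquad \xi=q^{-2}\frac{E(q^2)^5E(q^9)^4}{E(q)^4E(q^{18})^5},$$ and let $U$ be the operator on formal Laurent series defined by $U\left(\sum_{n\ge n_0}a_nq^n\right)=\sum_{3n\ge n_0}a_{3n}q^n$. Define integer matrices $(a(i,j))_{i,j\ge1}$ and $(b(i,j))_{i,j\ge1}$ as follows. The first three rows are (entries listed for $j=1,2,\dots$; all further entries in these rows are $0$): \begin{itemize} \item $a(1,\cdot)=(10,-36,27)$; $a(2,\cdot)=(-8,306,-2160,5508,-5832,2187)$; $a(3,\cdot)=(1,-360,10566,-99144,423549,-944784,1141614,-708588,177147)$; \item $b(1,\cdot)=(-9,252,-891,729)$; $b(2,\cdot)=(1,-378,8613,-54675,138510,-150903,59049)$; $b(3,\cdot)=(0,147,-14553,312255,-2617839,10764414,-23914845,29288304,-18600435,4782969)$. \end{itemize} For $i\ge4$ and $j\ge1$, both $m=a$ and $m=b$ satisfy $$m(i,j)=30m(i-1,j-1)-108m(i-1,j-2)+81m(i-1,j-3)-12m(i-2,j-1)+9m(i-2,j-2)+m(i-3,j-1),$$ where $m(i,j)=0$ whenever $j\le 0$. Then for every $i\ge1$, $$U(X^i)=\sum_{j\ge1}a(i,j)X^j,\qquad U(\xi X^i)=\sum_{j\ge1}b(i,j)X^j.$$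
   Context: All identities are identities of formal Laurent series in $q$; each row of the matrices has only finitely many nonzero entries. *)

(* Defs.v *)
From Stdlib Require Import NArith.
From HB Require Import structures.
From mathcomp Require Import all_boot all_order all_algebra.
Set Implicit Arguments. Unset Strict Implicit. Unset Printing Implicit Defensive.
Import Order.TTheory GRing.Theory Num.Theory.
Local Open Scope ring_scope.

(* Formal power series with integer coefficients: f n = coefficient of q^n. *)
Definition ps := nat -> int.

Definition psone : ps := fun n => if n == 0%N then 1 else 0.
Definition psmul (f g : ps) : ps := fun n => \sum_(k < n.+1) f k * g (n - k)%N.
Fixpoint psexp (f : ps) (k : nat) : ps :=
  match k with 0%N => psone | k'.+1 => psmul f (psexp f k') end.

(* Inverse of a power series with constant term 1:
   1/f = sum_{j>=0} (1 - f)^j; since (1-f) has zero constant term,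
   only j <= n contributes to the coefficient of q^n. *)
Definition psinv (f : ps) : ps :=
  fun n => \sum_(j < n.+1) psexp (fun m => psone m - f m) j n.

Definition psdiv (f g : ps) : ps := psmul f (psinv g).

(* E(q^m) = prod_{k>=1} (1 - q^{m k}); the coefficient of q^n only depends
   on the factors with k <= n. *)
Definition Eq (m : nat) : ps :=
  fun n => (\prod_(k < n) (1 - 'X^(m * k.+1)) : {poly int})`_n.

Definition Xps : ps :=
  psdiv (psmul (psexp (Eq 2) 4) (psexp (Eq 3) 8))
        (psmul (psexp (Eq 1) 8) (psexp (Eq 6) 4)).

Definition Xips : ps :=
  psdiv (psmul (psexp (Eq 2) 5) (psexp (Eq 9) 4))
        (psmul (psexp (Eq 1) 4) (psexp (Eq 18) 5)).

(* Formal Laurent series: q^(lval f) * (lps f). *)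
Record lser := LSer { lval : int; lps : ps }.

Definition lcoef (f : lser) (n : int) : int :=
  if lval f <= n then lps f `|n - lval f|%N else 0.

Definition lmul (f g : lser) : lser := LSer (lval f + lval g) (psmul (lps f) (lps g)).
Definition lofps (f : ps) : lser := LSer 0 f.

Definition Xl : lser := lofps Xps.
Definition xi : lser := LSer (-2) Xips.

Definition Ucoef (f : lser) : int -> int := fun n => lcoef f (3 * n).

(* integer literal from a binary natural (avoids unary nat literals) *)
Definition zn (b : BinNums.N) : int := Posz (nat_of_bin b).
Arguments zn b%_num.

(* The matrices: rows indexed from 1, columns from 1; entry at column 0 is 0. *)
Definition row_of (s : seq int) : nat -> int := fun j => nth 0 (0 :: s) j.

Definition shr (r : nat -> int) (j k : nat) : int :=
  if (k < j)%N then r (j - k)%N else 0.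

(* new row i from x = row (i-3), y = row (i-2), z = row (i-1) *)
Definition step (x y z : nat -> int) : nat -> int := fun j =>
  if j == 0%N then 0 else
  30 * shr z j 1 - 108 * shr z j 2 + 81 * shr z j 3
  - 12 * shr y j 1 + 9 * shr y j 2 + shr x j 1.

Fixpoint trip (r1 r2 r3 : nat -> int) (k : nat) :
    (nat -> int) * (nat -> int) * (nat -> int) :=
  match k with
  | 0%N => (r1, r2, r3)
  | k'.+1 => let '(x, y, z) := trip r1 r2 r3 k' in (y, z, step x y z)
  end.

(* row i (i >= 1) of the matrix with first rows r1 r2 r3 *)
Definition recmat (r1 r2 r3 : nat -> int) (i j : nat) : int :=
  (trip r1 r2 r3 i.-1).1.1 j.

Definition amat : nat -> nat -> int :=
  recmat (row_of [:: zn 10; - zn 36; zn 27])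
         (row_of [:: - zn 8; zn 306; - zn 2160; zn 5508; - zn 5832; zn 2187])
         (row_of [:: zn 1; - zn 360; zn 10566; - zn 99144; zn 423549; - zn 944784; zn 1141614; - zn 708588; zn 177147]).

Definition bmat : nat -> nat -> int :=
  recmat (row_of [:: - zn 9; zn 252; - zn 891; zn 729])
         (row_of [:: zn 1; - zn 378; zn 8613; - zn 54675; zn 138510; - zn 150903; zn 59049])
         (row_of [:: zn 0; zn 147; - zn 14553; zn 312255; - zn 2617839; zn 10764414; - zn 23914845; zn 29288304; - zn 18600435; zn 4782969]).

Definition Xcomb (c : nat -> int) (N : nat) : ps :=
  fun n => \sum_(1 <= j < N) c j * psexp Xps j n.

(* Main.v *)
(* Write w for the quotient 2q E(q^3)E(q^18)^3 / (E(q^6)E(q^9)^3) and Y = X(q^3).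
   The 3-dissections of phi(-q) and psi(q), which follow from the Jacobi triple
   product, express E(q)^2/E(q^2) and E(q^2)^2/E(q) through w; taking the product of
   the first one over q, omega q, omega^2 q (omega a primitive cube root of unity)
   gives Y(1 - w^3) = 1. With z = 1/(1 - w) this yields
   z^3 = Y(3z^2 - 3z + 1), X = z(3z^2 - 3z + 1) and q^2 xi = (g + q)^2 z, g w = 2q.
   Since U(Y f) = X U(f), the operators U and f |-> U(q^-2 (g + q)^2 f) are determined
   by their values at 1, z, z^2, and the recurrence is the cubic equation of X over Y. *)

Require Import Defs.
From Stdlib Require Import ZArith.
From HB Require Import structures.
From mathcomp Require Import all_boot all_order all_algebra.
From mathcomp Require Import boolp.
From mathcomp Require Import zify ring ssrZ.
Set Implicit Arguments.
Unset Strict Implicit.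
Unset Printing Implicit Defensive.
Import Order.TTheory GRing.Theory Num.Theory.
Local Open Scope ring_scope.

(** * The ring of formal power series *)

(** The obstacle is that the argument speaks of Laurent series, roots of unity and quotients of
    infinite products, while the ring built here is that of integer power series. The factor q^-2
    disappears because U(q^-2 f) reads the coefficients of f at exponents 3n + 2. Quotients
    disappear because every E(q^m) has constant term 1, so an identity may be checked after
    multiplication by such products. Infinite products are compared modulo q^N for every N. The gain
    from w is that its exponents are 1 modulo 3, while Y and g are series in q^3: U sends a + b w +
    c w^2, with a, b, c in q^3, to U(a), and Y w^3 = Y - 1 brings z and z^2 into this form. Since z
    is cubic over Z[Y], the span of 1, z, z^2 over Z[Y] is stable under multiplication by X, so the
    first three rows become a finite computation. In the recurrence, a factor Y^k of the cubic
    leaves the operator as X^k and shifts the columns by k. *)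

HB.instance Definition _ := gen_eqMixin ps.
HB.instance Definition _ := gen_choiceMixin ps.

Definition psadd (f g : ps) : ps := fun n => f n + g n.
Definition psopp (f : ps) : ps := fun n => - f n.
Definition pszero : ps := fun _ => 0.

Lemma psP (f g : ps) : (forall n, f n = g n) -> f = g.
Proof. by move=> fg; apply: funext. Qed.

Lemma psaddA : associative psadd.
Proof. by move=> f g h; apply: psP => n; rewrite /psadd addrA. Qed.
Lemma psaddC : commutative psadd.
Proof. by move=> f g; apply: psP => n; rewrite /psadd addrC. Qed.
Lemma psadd0 : left_id pszero psadd.
Proof. by move=> f; apply: psP => n; rewrite /psadd add0r. Qed.
Lemma psaddN : left_inverse pszero psopp psadd.
Proof. by move=> f; apply: psP => n; rewrite /psadd addNr. Qed.

HB.instance Definition _ := GRing.isZmodule.Build ps psaddA psaddC psadd0 psaddN.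

Definition psofpoly (p : {poly int}) : ps := fun n => p`_n.

Definition pstrunc (N : nat) (f : ps) : {poly int} := \poly_(i < N) f i.

Lemma psofpolyM (p r : {poly int}) :
  psofpoly (p * r) = psmul (psofpoly p) (psofpoly r).
Proof. by apply: psP => n; rewrite /psofpoly /psmul coefM. Qed.

Lemma coef_pstrunc N f n : (n < N)%N -> (pstrunc N f)`_n = f n.
Proof. by move=> lt; rewrite coef_poly lt. Qed.

Lemma psmul_congr (N : nat) (f f' g g' : ps) :
  (forall n, (n < N)%N -> f n = f' n) -> (forall n, (n < N)%N -> g n = g' n) ->
  forall n, (n < N)%N -> psmul f g n = psmul f' g' n.
Proof.
move=> ff gg n nN; rewrite /psmul; apply: eq_bigr => k _.
by rewrite ff ?gg //; have := ltn_ord k; lia.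
Qed.

Lemma psmul_trunc N f g n : (n < N)%N ->
  psmul f g n = psofpoly (pstrunc N f * pstrunc N g) n.
Proof.
move=> nN; rewrite psofpolyM.
by apply: (@psmul_congr N) => // k kN; rewrite /psofpoly coef_pstrunc.
Qed.

(** Coefficient n of either side depends only on the coefficients of index at most n, so
    associativity is inherited from polynomials by truncation. *)
Lemma psmulA : associative psmul.
Proof.
move=> f g h; apply: psP => n; set N := n.+1.
have nN : (n < N)%N by [].
have tr u k : (k < N)%N -> u k = psofpoly (pstrunc N u) k.
  by move=> kN; rewrite /psofpoly coef_pstrunc.
rewrite (@psmul_congr N _ (psofpoly (pstrunc N f)) _
          (psofpoly (pstrunc N g * pstrunc N h)) _ _ n) //; last first.
- by move=> k kN; apply: psmul_trunc.
- by move=> k kN; apply: tr.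
rewrite (@psmul_congr N (psmul f g) (psofpoly (pstrunc N f * pstrunc N g)) _
          (psofpoly (pstrunc N h)) _ _ n) //; last first.
- by move=> k kN; apply: tr.
- by move=> k kN; apply: psmul_trunc.
by rewrite -!psofpolyM mulrA.
Qed.

Lemma psmulC : commutative psmul.
Proof.
by move=> f g; apply: psP => n; rewrite !(@psmul_trunc n.+1) // mulrC.
Qed.

Lemma psmul1 : left_id psone psmul.
Proof.
move=> f; apply: psP => n; rewrite /psmul big_ord_recl big1 => [|i _].
  by rewrite /psone /= mul1r addr0 subn0.
by rewrite /psone mul0r.
Qed.

Lemma psmulDl : left_distributive psmul psadd.
Proof.
move=> f g h; apply: psP => n; rewrite /psmul /psadd -big_split /=.
by apply: eq_bigr => k _; rewrite mulrDl.
Qed.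

Lemma psone_neq0 : psone != 0.
Proof. by apply/eqP => /(congr1 (fun f : ps => f 0%N)). Qed.

HB.instance Definition _ :=
  GRing.Zmodule_isComNzRing.Build ps psmulA psmulC psmul1 psmulDl psone_neq0.

Lemma psE : (forall (f g : ps) n, (f + g) n = f n + g n) *
  (forall (f : ps) n, (- f) n = - f n) * (forall n, (0 : ps) n = 0) *
  (forall n, (1 : ps) n = (n == 0%N)%:R).
Proof.
by split=> // n; rewrite -[1%R]/psone /psone; case: eqP.
Qed.

Lemma psexpE (f : ps) k : psexp f k = f ^+ k.
Proof. by elim: k => [|k IH] //=; rewrite IH exprS. Qed.

Lemma ps_mulE (f g : ps) : psmul f g = f * g.
Proof. by []. Qed.

Lemma ps_coefM (f g : ps) n : (f * g) n = \sum_(k < n.+1) f k * g (n - k)%N.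
Proof. by []. Qed.

Lemma ps_natrM (c : nat) (f : ps) n : (c%:R * f) n = c%:R * f n.
Proof.
elim: c => [|c IH]; first by rewrite !mul0r.
by rewrite -!natr1 !mulrDl !mul1r psE IH.
Qed.

Lemma ps_intrM (c : int) (f : ps) n : (c%:~R * f) n = c * f n.
Proof.
case: c => c; first by rewrite -pmulrn ps_natrM natz.
by rewrite NegzE !mulrNz mulNr -pmulrn psE ps_natrM natz mulNr.
Qed.

Lemma ps_sumE (I : Type) (r : seq I) (P : pred I) (F : I -> ps) n :
  (\sum_(i <- r | P i) F i) n = \sum_(i <- r | P i) F i n.
Proof. by apply: (big_morph (fun f : ps => f n)). Qed.

Definition psq : ps := fun n => (n == 1%N)%:R.

Lemma psq_exp k n : (psq ^+ k) n = (n == k)%:R.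
Proof.
elim: k n => [|k IH] n; first by rewrite expr0 psE.
rewrite exprS ps_coefM; case: n => [|n].
  by rewrite big_ord1 /psq mul0r.
rewrite big_ord_recl big_ord_recl big1 => [|i _]; last by rewrite /psq /= mul0r.
by rewrite /psq /= /bump /= mul0r mul1r add0r addr0 subn1 /= IH.
Qed.

Lemma coef_psqM k (f : ps) n :
  (psq ^+ k * f) n = if (n < k)%N then 0 else f (n - k)%N.
Proof.
rewrite ps_coefM; case: ltnP => nk.
  apply: big1 => i _; rewrite psq_exp; case: eqP => [ik|]; last by rewrite mul0r.
  by have := ltn_ord i; lia.
have kn : (k < n.+1)%N by [].
rewrite (bigD1 (Ordinal kn)) //= psq_exp eqxx mul1r big1 ?addr0 // => i ik.
rewrite psq_exp; case: eqP => [e|]; last by rewrite mul0r.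
by move: ik; rewrite -val_eqE /= e eqxx.
Qed.

Lemma psq_mulI k : injective ( *%R (psq ^+ k)).
Proof.
move=> f g e; apply: psP => n.
have := congr1 (fun h : ps => h (k + n)%N) e.
by rewrite /= !coef_psqM ltnNge leq_addr addKn.
Qed.

(** * Congruence of power series modulo q^N *)

Definition eqm (N : nat) (f g : ps) := forall n, (n < N)%N -> f n = g n.

Lemma eqm_eq f g : (forall N, eqm N f g) -> f = g.
Proof. by move=> e; apply: psP => n; apply: (e n.+1). Qed.
Lemma eqm_refl N f : eqm N f f. Proof. by []. Qed.
Lemma eqm_sym N f g : eqm N f g -> eqm N g f.
Proof. by move=> e n nN; rewrite e. Qed.
Lemma eqm_trans N g f h : eqm N f g -> eqm N g h -> eqm N f h.
Proof. by move=> e e' n nN; rewrite e ?e'. Qed.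
Lemma eqm_le M N f g : (M <= N)%N -> eqm N f g -> eqm M f g.
Proof. by move=> MN e n nM; apply: e; apply: leq_trans MN. Qed.
Lemma eqmM N f f' g g' : eqm N f f' -> eqm N g g' -> eqm N (f * g) (f' * g').
Proof. exact: psmul_congr. Qed.
Lemma eqmD N f f' g g' : eqm N f f' -> eqm N g g' -> eqm N (f + g) (f' + g').
Proof. by move=> e e' n nN; rewrite !psE e ?e'. Qed.
Lemma eqmN N f f' : eqm N f f' -> eqm N (- f) (- f').
Proof. by move=> e n nN; rewrite !psE e. Qed.
Lemma eqm_prod N (I : Type) (r : seq I) (P : pred I) (F G : I -> ps) :
  (forall i, P i -> eqm N (F i) (G i)) ->
  eqm N (\prod_(i <- r | P i) F i) (\prod_(i <- r | P i) G i).
Proof. by move=> e; elim/big_rec2: _ => // i f g Pi fg; apply: eqmM => //; apply: e. Qed.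
Lemma eqm_prod1 N (I : Type) (r : seq I) (P : pred I) (F : I -> ps) :
  (forall i, P i -> eqm N (F i) 1) -> eqm N (\prod_(i <- r | P i) F i) 1.
Proof.
by move=> e; elim/big_rec: _ => // i f Pi f1; rewrite -[1]mulr1; apply: eqmM => //; apply: e.
Qed.
Lemma eqm_sum N (I : Type) (r : seq I) (P : pred I) (F G : I -> ps) :
  (forall i, P i -> eqm N (F i) (G i)) ->
  eqm N (\sum_(i <- r | P i) F i) (\sum_(i <- r | P i) G i).
Proof. by move=> e; elim/big_rec2: _ => // i f g Pi fg; apply: eqmD => //; apply: e. Qed.
Lemma eqm_psqM N k f g : eqm N f g -> eqm (k + N) (psq ^+ k * f) (psq ^+ k * g).
Proof. by move=> e n nN; rewrite !coef_psqM; case: ltnP => // kn; apply: e; lia. Qed.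
Lemma eqm_psq N k : (N <= k)%N -> eqm N (psq ^+ k) 0.
Proof. by move=> Nk n nN; rewrite psq_exp psE; case: eqP => [e|] //; lia. Qed.

Lemma eqm_exp0 (f : ps) k : f 0%N = 0 -> eqm k (f ^+ k) 0.
Proof.
move=> f0; elim: k => [|k IH] // n nk; rewrite exprS ps_coefM big1 // => i _.
case: (posnP i) => [->|i0]; first by rewrite f0 mul0r.
by rewrite IH ?psE ?mulr0 //; have := ltn_ord i; lia.
Qed.

(** With u = 1 - f, the power u^j vanishes modulo q^j, so modulo q^N the series [psinv f] is a
    finite geometric sum and the product telescopes to 1 - u^N. *)
Lemma psinvE (f : ps) : f 0%N = 1 -> f * psinv f = 1.
Proof.
move=> f1; set u := 1 - f.
have u0 : u 0%N = 0 by rewrite /u !psE f1 subrr.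
apply: eqm_eq => N.
have inv : eqm N (psinv f) (\sum_(j < N) u ^+ j).
  move=> n nN; rewrite ps_sumE /psinv (big_ord_widen_cond N predT
    (fun j => psexp (fun m => psone m - f m) j n)) //=.
  rewrite [RHS](bigID (fun i : 'I_N => (i < n.+1)%N)) /= [X in _ + X]big1 ?addr0.
    by apply: eq_bigr => i _; rewrite psexpE.
  by move=> i ni; rewrite (eqm_exp0 (k := i) u0) ?psE //; lia.
apply: eqm_trans (eqmM (eqm_refl f) inv) _.
have -> : f = 1 - u by rewrite /u; ring.
have -> : (1 - u) * \sum_(j < N) u ^+ j = 1 - u ^+ N.
  by rewrite -[1 - u in LHS]opprB mulNr -subrX1 [LHS]opprB.
have := eqmD (eqm_refl 1) (eqmN (eqm_exp0 (k := N) u0)).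
by rewrite oppr0 addr0.
Qed.

(** This is how denominators are cleared below: any product of series E(q^m) can be cancelled. *)
Lemma ps_unit_mulI (f : ps) : f 0%N = 1 -> injective ( *%R f).
Proof.
move=> f1 g h e; rewrite -[g]mul1r -[h]mul1r -(psinvE f1) [f * _]mulrC -!mulrA.
by rewrite e.
Qed.

Lemma ps_coef0M (f g : ps) : (f * g) 0%N = f 0%N * g 0%N.
Proof. by rewrite ps_coefM big_ord1. Qed.

Lemma ps_coef0X (f : ps) k : f 0%N = 1 -> (f ^+ k) 0%N = 1.
Proof. by move=> f1; elim: k => [|k IH]; rewrite ?psE // exprS ps_coef0M f1 IH. Qed.

(** * Infinite products *)

Definition conv (F : nat -> ps) := forall k, eqm k (F k) 1.

(** Under [conv], the factors of index above n are 1 modulo q^(n+1), so this is the limit of the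
    partial products. *)
Definition iprod (F : nat -> ps) : ps := fun n => (\prod_(k < n.+1) F k) n.

Lemma iprod_eqm F N M : conv F -> (N <= M)%N ->
  eqm N (iprod F) (\prod_(k < M) F k).
Proof.
move=> cF NM n nN; rewrite /iprod.
have -> : M = (n.+1 + (M - n.+1))%N by lia.
rewrite big_split_ord /=.
have e : eqm n.+1 (\prod_(i < M - n.+1) F (n.+1 + i)%N) 1.
  by apply: eqm_prod1 => i _; apply: eqm_le (cF _); rewrite leq_addr.
have := eqmM (eqm_refl (\prod_(k < n.+1) F k)) e.
by rewrite mulr1 => ->.
Qed.

Lemma eq_iprod F G : (forall k, F k = G k) -> iprod F = iprod G.
Proof. by move=> FG; rewrite /iprod; apply: psP => n; under eq_bigr do rewrite FG. Qed.

Lemma convM F G : conv F -> conv G -> conv (fun k => F k * G k).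
Proof. by move=> cF cG k; rewrite -[1]mulr1; apply: eqmM. Qed.

Lemma conv_prod d (F : nat -> nat -> ps) : (forall r, conv (F r)) -> conv (fun k => \prod_(r < d) F r k).
Proof.
by move=> cF k; apply: eqm_prod1 => i _; apply: cF.
Qed.

Lemma iprodM F G : conv F -> conv G ->
  iprod (fun k => F k * G k) = iprod F * iprod G.
Proof.
move=> cF cG; apply: eqm_eq => N.
apply: eqm_trans (iprod_eqm (convM cF cG) (leqnn N)) _.
rewrite big_split /=; apply: eqm_sym.
by apply: eqmM; apply: iprod_eqm.
Qed.

Lemma iprod1 : iprod (fun _ => 1) = 1.
Proof.
apply: eqm_eq => N; apply: eqm_trans (iprod_eqm (M := N) _ _) _ => //.
by rewrite big1.
Qed.

Lemma iprod_prod d (F : nat -> nat -> ps) : (forall r, conv (F r)) ->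
  iprod (fun k => \prod_(r < d) F r k) = \prod_(r < d) iprod (F r).
Proof.
move=> cF; elim: d => [|d IH].
  by rewrite big_ord0 -[RHS]iprod1; apply: eq_iprod => k; rewrite big_ord0.
rewrite big_ord_recr /= -IH -iprodM //; last exact: conv_prod.
by apply: eq_iprod => k; rewrite big_ord_recr.
Qed.

Lemma conv_block d r F : (0 < d)%N -> conv F -> conv (fun j => F (d * j + r)%N).
Proof. by move=> d0 cF j; apply: eqm_le (cF _); nia. Qed.

Lemma prod_block (R : comNzRingType) d n (F : nat -> R) :
  \prod_(k < d * n) F k = \prod_(j < n) \prod_(r < d) F (d * j + r)%N.
Proof.
elim: n => [|n IH]; first by rewrite muln0 !big_ord0.
by rewrite mulnS addnC big_split_ord big_ord_recr /= IH.
Qed.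

(** The factors are sorted by the residue of their index modulo d; a partial product of length d N
    regroups exactly into N blocks. *)
Lemma iprod_block d F : (0 < d)%N -> conv F ->
  iprod F = \prod_(r < d) iprod (fun j => F (d * j + r)%N).
Proof.
move=> d0 cF; rewrite -(@iprod_prod d (fun r j => F (d * j + r)%N)); last first.
  by move=> r; apply: conv_block.
apply: eqm_eq => N.
have dN : (N <= d * N)%N by nia.
apply: eqm_trans (iprod_eqm cF dN) _; rewrite prod_block; apply: eqm_sym.
apply: iprod_eqm => //; apply: (@conv_prod d (fun r j => F (d * j + r)%N)) => r.
exact: conv_block.
Qed.

Lemma iprod_recl F : conv F -> iprod F = F 0%N * iprod (fun k => F k.+1).
Proof.
move=> cF; apply: eqm_eq => N.
apply: eqm_trans (iprod_eqm cF (leqnSn N)) _; rewrite big_ord_recl.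
apply: eqmM => //; apply: eqm_sym; apply: iprod_eqm => // k.
exact: eqm_le (leqnSn k) (cF k.+1).
Qed.

(** The q-Pochhammer symbol (-c q^r; q^d) with infinitely many factors. *)
Definition qfac (c : ps) d r : ps := iprod (fun j => 1 + c * psq ^+ (d * j + r)).

Lemma conv_qfac c d r : (0 < d)%N -> conv (fun j => 1 + c * psq ^+ (d * j + r)).
Proof.
move=> d0 j; rewrite -[1 in X in eqm _ _ X]addr0; apply: eqmD => //.
rewrite -[0 in X in eqm _ _ X](mulr0 c); apply: eqmM => //; apply: eqm_psq; nia.
Qed.

Lemma qfac_block e c d r : (0 < d)%N -> (0 < e)%N ->
  qfac c d r = \prod_(i < e) qfac c (d * e) (d * i + r).
Proof.
move=> d0 e0; rewrite /qfac (@iprod_block e) //; last exact: conv_qfac.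
apply: eq_bigr => i _; apply: eq_iprod => j.
by congr (1 + c * psq ^+ _); lia.
Qed.

Lemma qfac_recl c d r : (0 < d)%N -> qfac c d r = (1 + c * psq ^+ r) * qfac c d (d + r).
Proof.
move=> d0; rewrite /qfac iprod_recl ?muln0; last exact: conv_qfac.
by congr (_ * _); apply: eq_iprod => j; congr (1 + c * psq ^+ _); lia.
Qed.

Lemma qfac_plusM d r : (0 < d)%N -> qfac 1 d r * qfac (-1) d r = qfac (-1) (2 * d) (2 * r).
Proof.
move=> d0; rewrite /qfac -iprodM; try exact: conv_qfac.
apply: eq_iprod => j.
have -> : (2 * d * j + 2 * r = (d * j + r) * 2)%N by lia.
by rewrite exprM; ring.
Qed.

Lemma qfac0 c d r : (0 < d)%N -> (0 < r)%N -> qfac c d r 0%N = 1.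
Proof.
move=> d0 r0; rewrite /qfac /iprod big_ord1 muln0 add0n psE ps_coef0M psq_exp.
by rewrite psE eq_sym (gtn_eqF r0) mulr0.
Qed.

Lemma psofpoly_rmorph : {morph psofpoly : p r / p * r >-> p * r}.
Proof. exact: psofpolyM. Qed.

Lemma psofpoly1 : psofpoly 1 = 1.
Proof. by apply: psP => n; rewrite /psofpoly coef1 psE. Qed.

Lemma EqE m : (0 < m)%N -> Eq m = qfac (-1) m m.
Proof.
move=> m0; apply: psP => n; rewrite /qfac /iprod /Eq.
rewrite -[LHS]/(psofpoly (\prod_(k < n) (1 - 'X^(m * k.+1)) : {poly int}) n).
rewrite (big_morph _ psofpoly_rmorph psofpoly1) big_ord_recr /=.
have e k : psofpoly (1 - 'X^(m * k.+1) : {poly int}) = 1 + -1 * psq ^+ (m * k + m).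
  apply: psP => i; rewrite mulN1r !psE psq_exp /psofpoly coefB coef1 coefXn.
  by rewrite mulnS addnC.
under eq_bigr do rewrite e.
set P := \prod_(k < n) _.
(* [Eq] reads coefficient n from n factors and [iprod] from n + 1; the additional factor has
   exponent m(n + 1) > n. *)
have : eqm n.+1 (P * (1 + -1 * psq ^+ (m * n + m))) (P * (1 + -1 * 0)).
  by apply: eqmM => //; apply: eqmD => //; apply: eqmM => //; apply: eqm_psq; nia.
by rewrite mulr0 addr0 mulr1 => ->.
Qed.

Lemma Eq0 m : (0 < m)%N -> Eq m 0%N = 1.
Proof. by move=> m0; rewrite EqE // qfac0. Qed.

(** * The Jacobi triple product *)

Section GaussBinomial.
Variables (R : comNzRingType) (p : R).

(** The Gaussian binomial coefficient in p. This Pascal rule is the one produced by splitting off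
    the last factor y + x p^N in [gauss_binomial]. *)
Fixpoint gauss (N k : nat) : R :=
  match N, k with
  | _, 0 => 1
  | 0, _.+1 => 0
  | N'.+1, k'.+1 => gauss N' k'.+1 + p ^+ (N' - k') * gauss N' k'
  end.

Lemma gauss_small N k : (N < k)%N -> gauss N k = 0.
Proof.
elim: N k => [|N IH] [|k] //= Nk.
by rewrite !IH ?mulr0 ?addr0 //; lia.
Qed.

Lemma gauss_prod N k : (k <= N)%N ->
  gauss N k * \prod_(j < k) (1 - p ^+ j.+1) * \prod_(j < N - k) (1 - p ^+ j.+1) =
  \prod_(j < N) (1 - p ^+ j.+1).
Proof.
elim: N k => [|N IH] [|k] //= kN; try by rewrite big_ord0 !mul1r.
rewrite subSS [\prod_(j < k.+1) _]big_ord_recr [RHS]big_ord_recr /=.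
have := IH k kN; set A := gauss N k; set B := \prod_(j < k) _; set D := \prod_(j < N) _.
set C := \prod_(j < N - k) _ => IHk.
move: kN; rewrite ltnS leq_eqVlt => /orP[/eqP e|kN].
  have -> : gauss N k.+1 = 0 by apply: gauss_small; lia.
  have -> : (N - k = 0)%N by lia.
  by rewrite -IHk; clearbody A B C D; rewrite -e; ring.
have := IH k.+1 kN; rewrite [\prod_(j < k.+1) _]big_ord_recr /= -/B.
move: @C IHk; have -> : (N - k = (N - k.+1).+1)%N by lia.
rewrite big_ord_recr /=; set C := \prod_(j < N - k.+1) _.
set F := gauss N k.+1 => IHk IHk1.
have -> : p ^+ N.+1 = p ^+ (N - k.+1).+1 * p ^+ k.+1.
  by rewrite -exprD; congr (_ ^+ _); lia.
move: IHk IHk1; set s := p ^+ (N - k.+1).+1; set t := p ^+ k.+1 => IHk IHk1.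
(* Here s = p^(N-k) and t = p^(k+1), so 1 - p^(N+1) = (1 - s) + s (1 - t) matches the two terms of
   the Pascal rule. *)
transitivity ((F * (B * (1 - t)) * C) * (1 - s) + s * (1 - t) * (A * B * (C * (1 - s)))).
  by ring.
by rewrite IHk IHk1 -/D; ring.
Qed.

(** The q-binomial theorem, made homogeneous in x and y so that taking y = p^n later replaces
    negative powers of q. *)
Lemma gauss_binomial (x y : R) N :
  \prod_(k < N) (y + x * p ^+ k) =
  \sum_(k < N.+1) p ^+ 'C(k, 2) * gauss N k * x ^+ k * y ^+ (N - k).
Proof.
elim: N => [|N IH].
  by rewrite big_ord0 big_ord1 /= !expr0 !mulr1.
rewrite big_ord_recr /= IH mulrDr !mulr_suml.
rewrite [RHS]big_ord_recl /= subn0 !(expr0, mul1r, mulr1).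
have -> : \sum_(i < N.+1) p ^+ 'C(i, 2) * gauss N i * x ^+ i * y ^+ (N - i) * y =
  y ^+ N.+1 + \sum_(i < N.+1) p ^+ 'C(i.+1, 2) * gauss N i.+1 * x ^+ i.+1 * y ^+ (N - i).
  rewrite big_ord_recl [in RHS]big_ord_recr /= (@gauss_small N N.+1) // mulr0 !mul0r addr0.
  rewrite subn0 -mulrA -exprSr; congr (_ + _); first by case: (N) => [|?] /=; rewrite !(expr0, mul1r).
  apply: eq_bigr => i _; rewrite /bump /= add1n -!mulrA -exprSr.
  by do 3 congr (_ * _); congr (_ ^+ _); have := ltn_ord i; lia.
rewrite -addrA; congr (_ + _); rewrite -big_split /=.
apply: eq_bigr => i _; rewrite /bump /= !add1n subSS binS bin1 exprS.
have -> : p ^+ N = p ^+ i * p ^+ (N - i).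
  by rewrite -exprD; congr (_ ^+ _); have := ltn_ord i; lia.
by rewrite exprD; ring.
Qed.

End GaussBinomial.

(* [theta_exp a b m = a m(m+1)/2 + b m(m-1)/2]. *)
Definition theta_exp (a b : nat) (m : int) : nat :=
  match m with
  | Posz l => a * 'C(l.+1, 2) + b * 'C(l, 2)
  | Negz l => a * 'C(l.+1, 2) + b * 'C(l.+2, 2)
  end.

Lemma bin2_double n : ('C(n, 2).*2 = n * n.-1)%N.
Proof. by rewrite bin2 halfK; case: n => // n; rewrite /= oddM /= andNb subn0. Qed.

(** Doubling makes the exponent a polynomial in the signed index, so that [theta_expP] reduces
    equalities of exponents to [ring]. *)
Lemma theta_expE a b m :
  (theta_exp a b m).*2%:Z = a%:Z * (m * (m + 1)) + b%:Z * (m * (m - 1)).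
Proof.
case: m => l; rewrite /= doubleD !doubleMr !bin2_double /= ?NegzE; last by nia.
by case: l => [|l] /=; nia.
Qed.

Lemma theta_expP a b m e :
  e.*2%:Z = a%:Z * (m * (m + 1)) + b%:Z * (m * (m - 1)) -> theta_exp a b m = e.
Proof. by rewrite -theta_expE; lia. Qed.

(** The bilateral theta series cut to indices m = k - n from -n to n. As it is used with c^2 = 1,
    the power c^m may be written with |m|. *)
Definition theta_sum (c : ps) a b n : ps :=
  \sum_(k < n.*2.+1) c ^+ `|k%:Z - n%:Z|%N * psq ^+ theta_exp a b (k%:Z - n%:Z).

(** This is the q-binomial theorem with 2n factors, x = c q^a and y = p^n. The factors k >= n give
    the first product; those with k < n give, in reverse order, the second, because c + q^e = c (1 +
    c q^e). *)
Lemma finite_triple_product (c : ps) a b n : c * c = 1 ->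
  \prod_(j < n) (1 + c * psq ^+ ((a + b) * j + a)) *
  \prod_(j < n) (1 + c * psq ^+ ((a + b) * j + b)) =
  \sum_(k < n.*2.+1) c ^+ `|k%:Z - n%:Z|%N * psq ^+ theta_exp a b (k%:Z - n%:Z) *
                     gauss (psq ^+ (a + b)) n.*2 k.
Proof.
move=> cc; set d := (a + b)%N; set p := psq ^+ d.
have c2 m : c ^+ m.*2 = 1 by rewrite -mul2n exprM expr2 cc expr1n.
have := gauss_binomial p (c * psq ^+ a) (p ^+ n) n.*2.
(* The power of q taken out: q^(a + d i) from each factor i < n, and p^n from each of the n
   others. *)
set K := (a * n + d * 'C(n, 2) + d * n * n)%N.
have -> : \prod_(k < n.*2) (p ^+ n + c * psq ^+ a * p ^+ k) =
   psq ^+ K * (c ^+ n * (\prod_(j < n) (1 + c * psq ^+ (d * j + a)) *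
   \prod_(j < n) (1 + c * psq ^+ (d * j + b)))).
  rewrite -addnn big_split_ord /=.
  have -> : \prod_(i < n) (p ^+ n + c * psq ^+ a * p ^+ (n + i)) =
     psq ^+ (d * n * n) * \prod_(j < n) (1 + c * psq ^+ (d * j + a)).
    have -> : psq ^+ (d * n * n) = \prod_(j < n) psq ^+ (d * n).
      by rewrite prodr_const card_ord exprM.
    rewrite -big_split /=.
    apply: eq_bigr => j _; rewrite /p -!exprM mulnDr !exprD; ring.
  have -> : \prod_(i < n) (p ^+ n + c * psq ^+ a * p ^+ i) =
     psq ^+ (a * n + d * 'C(n, 2)) * c ^+ n * \prod_(j < n) (1 + c * psq ^+ (d * j + b)).
    rewrite [\prod_(j < n) (1 + _)](reindex_inj rev_ord_inj) /=.
    have -> : psq ^+ (a * n + d * 'C(n, 2)) = \prod_(i < n) psq ^+ (a + d * i).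
      by rewrite prodrXr big_split sum_nat_const card_ord -big_distrr /= -(big_mkord predT id) bin2_sum mulnC.
    have -> : c ^+ n = \prod_(j < n) c by rewrite prodr_const card_ord.
    rewrite -!big_split /=.
    apply: eq_bigr => j _; rewrite /p -!exprM.
    have -> : (d * n = (a + d * j) + (d * (n - j.+1) + b))%N.
      by rewrite /d; have := ltn_ord j; nia.
    rewrite [psq ^+ (a + _ + _)]exprD [psq ^+ (a + _)]exprD.
    set x := psq ^+ (_ * (n - _) + b); set y := psq ^+ (d * j); set z := psq ^+ a.
    transitivity (z * y * c + z * y * x * (c * c)); last by ring.
    by rewrite cc mulr1 addrC; congr (_ + _); rewrite [RHS]mulrC mulrA.
  by rewrite /K !exprD -!mulrA; congr (_ * (_ * _)); rewrite [RHS]mulrCA [in RHS](mulrC (\prod_(j < n) _)) (mulrCA (\prod_(j < n) _)).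
have -> : \sum_(k < n.*2.+1) p ^+ 'C(k, 2) * gauss p n.*2 k * (c * psq ^+ a) ^+ k *
    (p ^+ n) ^+ (n.*2 - k) = psq ^+ K * (c ^+ n * \sum_(k < n.*2.+1)
   c ^+ `|k%:Z - n%:Z|%N * psq ^+ theta_exp a b (k%:Z - n%:Z) * gauss p n.*2 k).
  rewrite !mulr_sumr; apply: eq_bigr => k _.
  rewrite exprMn /p -!exprM.
  have -> : c ^+ k = c ^+ n * c ^+ `|k%:Z - n%:Z|%N.
    rewrite -exprD; case: (leqP k n) => kn.
      have -> : (n + `|k%:Z - n%:Z|%N = k + (n - k).*2)%N by lia.
      by rewrite exprD c2 mulr1.
    have -> : (n + `|k%:Z - n%:Z|%N = k)%N by lia.
    by [].
  (* Completing the square around k = n. The identity is doubled to remove the binomials and moved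
     to integers to remove the truncated subtraction. *)
  have E : (d * 'C(k, 2) + a * k + d * n * (n.*2 - k) = K + theta_exp a b (k%:Z - n%:Z))%N.
    have := theta_expE a b (k%:Z - n%:Z); set t := theta_exp _ _ _.
    have := bin2_double n; have := bin2_double k; rewrite /K.
    set u := 'C(k, 2); set v := 'C(n, 2) => hu hv ht.
    have [l hl] : exists l, l = (n.*2 - k)%N by exists (n.*2 - k)%N.
    have hk : n.*2 = (l + k)%N by have := ltn_ord k; lia.
    rewrite -hl; clear hl; move: (nat_of_ord k) hk hu ht => r hk hu ht.
    have hu' : u.*2%:Z = r%:Z * (r%:Z - 1) by case: (r) hu => [|i] /=; nia.
    have hv' : v.*2%:Z = n%:Z * (n%:Z - 1) by case: (n) hv => [|i] /=; nia.
    have {}hk : l%:Z = 2 * n%:Z - r%:Z by lia.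
    have Hu : 2 * (d%:Z * u%:Z) = d%:Z * (r%:Z * (r%:Z - 1)) by rewrite -hu'; nia.
    have Hv : 2 * (d%:Z * v%:Z) = d%:Z * (n%:Z * (n%:Z - 1)) by rewrite -hv'; nia.
    have Ht : 2 * t%:Z = a%:Z * ((r%:Z - n%:Z) * (r%:Z - n%:Z + 1)) +
      b%:Z * ((r%:Z - n%:Z) * (r%:Z - n%:Z - 1)) by rewrite -ht; lia.
    suff : 2 * (d * u + a * r + d * n * l)%N%:Z = 2 * (a * n + d * v + d * n * n + t)%N%:Z.
      by lia.
    rewrite !(PoszD, PoszM) !mulrDr Hu Hv Ht hk /d PoszD; ring.
  have {}E : psq ^+ (d * 'C(k, 2)) * psq ^+ (a * k) * psq ^+ (d * (n * (n.*2 - k))) =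
      psq ^+ K * psq ^+ theta_exp a b (k%:Z - n%:Z) by rewrite mulnA -!exprD E.
  move: E; set A1 := psq ^+ _; set A2 := psq ^+ _; set A3 := psq ^+ _.
  set A4 := psq ^+ K; set A5 := psq ^+ _; set G := gauss _ _ _.
  set U := c ^+ n; set V := c ^+ _ => E.
  transitivity (A1 * A2 * A3 * (U * V * G)); last rewrite E;
    clearbody A1 A2 A3 A4 A5 G U V; ring.
move/psq_mulI; move/(congr1 (fun f => c ^+ n * f)).
by rewrite !mulrA -!exprD addnn c2 !mul1r.
Qed.

(** To this precision the three products in [gauss_prod], of lengths k, n - k and n, all agree with
    E(q^d), and one copy of it cancels. *)
Lemma gauss_limit d n k : (0 < d)%N -> (k <= n)%N ->
  eqm (minn k (n - k)).+1 (gauss (psq ^+ d) n k * Eq d) 1.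
Proof.
move=> d0 kn; set l := minn k (n - k).
have P r : (l <= r)%N -> eqm l.+1 (\prod_(j < r) (1 - (psq ^+ d) ^+ j.+1)) (Eq d).
  move=> lr; rewrite EqE //; apply: eqm_sym.
  have c := @conv_qfac (-1) d d d0.
  apply: eqm_trans (iprod_eqm c (_ : (l.+1 <= r.+1)%N)) _ => //.
  rewrite big_ord_recr /=.
  have e0 : eqm l.+1 (1 + -1 * psq ^+ (d * r + d)) (1 + -1 * 0).
    by apply: eqmD => //; apply: eqmM => //; apply: eqm_psq; nia.
  apply: eqm_trans (eqmM (eqm_refl _) e0) _; rewrite mulr0 addr0 mulr1.
  apply: eqm_prod => i _; rewrite mulN1r -exprM mulnS [(d + _)%N]addnC.
  exact: eqm_refl.
have := gauss_prod (psq ^+ d) kn.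
set G := gauss _ _ _ => e.
have {e} : eqm l.+1 (G * Eq d * Eq d) (Eq d).
  apply: eqm_trans (P n _); last by rewrite /l; lia.
  by rewrite -e; apply: eqmM; [apply: eqmM => //|]; apply/eqm_sym/P; rewrite /l; lia.
move=> e; have := eqmM e (eqm_refl (psinv (Eq d))).
by rewrite -[_ * _ * Eq d * _]mulrA psinvE ?Eq0 // mulr1.
Qed.

(** The loss of one is real: for a = 1, b = 0, m = -1 the exponent is 0. *)
Lemma theta_exp_ge a b m : (0 < a + b)%N -> (`|m|%N <= (theta_exp a b m).+1)%N.
Proof.
move=> ab; have := theta_expE a b m; move: (theta_exp a b m) => t e.
case: m e => l e; rewrite ?NegzE in e *; nia.
Qed.

(** In the term of index m = k - n the Gaussian coefficient times E is 1 modulo q^(n-|m|+1), and the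
    monomial in front contributes at least |m| - 1 more, so precision q^n is reached. *)
Theorem triple_product (c : ps) a b n : c * c = 1 -> (0 < a + b)%N ->
  eqm n (qfac c (a + b) a * qfac c (a + b) b * Eq (a + b)) (theta_sum c a b n).
Proof.
move=> cc ab.
have := eqmM (iprod_eqm (@conv_qfac c (a + b) a ab) (leqnn n))
             (iprod_eqm (@conv_qfac c (a + b) b ab) (leqnn n)).
rewrite finite_triple_product // => e.
apply: eqm_trans (eqmM e (eqm_refl _)) _; rewrite mulr_suml.
apply: eqm_sum => k _; rewrite -mulrA.
have kn : (k <= n.*2)%N by rewrite -ltnS.
have {}e := gauss_limit ab kn.
have := eqm_psqM (k := theta_exp a b (k%:Z - n%:Z)) e; rewrite mulr1 => {}e.
rewrite -!mulrA; apply: eqmM => //; apply: eqm_le e.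
have := @theta_exp_ge a b (k%:Z - n%:Z) ab.
have := ltn_ord k; lia.
Qed.

(** The reflection m -> -m exchanges a and b. *)
Lemma theta_sumN c a b n : theta_sum c a b n = theta_sum c b a n.
Proof.
rewrite /theta_sum (reindex_inj rev_ord_inj) /=; apply: eq_bigr => k _.
have -> : (n.*2.+1 - k.+1)%N%:Z - n%:Z = - (k%:Z - n%:Z) by have := ltn_ord k; lia.
rewrite abszN; congr (_ * psq ^+ _); apply: theta_expP; rewrite theta_expE; ring.
Qed.

Lemma sum_block3 (V : nmodType) n (F : nat -> V) :
  \sum_(k < 3 * n) F k = \sum_(j < n) (F (3 * j)%N + F (3 * j).+1 + F (3 * j).+2).
Proof.
elim: n => [|n IH]; first by rewrite muln0 !big_ord0.
by rewrite mulnS addnC !addnS addn0 !big_ord_recr /= IH !addrA.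
Qed.

(** Since 2(3n + 1) + 1 = 3(2n + 1), cutting at 3n + 1 leaves complete triples 3m - 1, 3m, 3m + 1
    with m from -n to n. *)
Lemma theta_sum_block3 c a b n :
  theta_sum c a b (3 * n).+1 = \sum_(k < n.*2.+1) let m := k%:Z - n%:Z in
    (c ^+ absz (3 * m - 1)%R * psq ^+ theta_exp a b (3 * m - 1) +
     c ^+ absz (3 * m)%R * psq ^+ theta_exp a b (3 * m) +
     c ^+ absz (3 * m + 1)%R * psq ^+ theta_exp a b (3 * m + 1)).
Proof.
rewrite /theta_sum; have -> : ((3 * n).+1.*2.+1 = 3 * n.*2.+1)%N by lia.
rewrite (sum_block3 _ (fun k => c ^+ `|k%:Z - (3 * n).+1%:Z|%N *
   psq ^+ theta_exp a b (k%:Z - (3 * n).+1%:Z))).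
apply: eq_bigr => k _ /=.
have -> : (3 * k)%N%:Z - (3 * n).+1%:Z = 3 * (k%:Z - n%:Z) - 1 by lia.
have -> : (3 * k).+1%:Z - (3 * n).+1%:Z = 3 * (k%:Z - n%:Z) by lia.
by have -> : (3 * k).+2%:Z - (3 * n).+1%:Z = 3 * (k%:Z - n%:Z) + 1 by lia.
Qed.

(** In this notation [theta (-1) 1 1] is phi(-q) and [theta 1 1 0] is 2 psi(q), as every triangular
    number arises from two indices. *)
Definition theta (c : ps) a b : ps := qfac c (a + b) a * qfac c (a + b) b * Eq (a + b).

Lemma sign_mul3 (m : int) : (-1 : ps) ^+ absz (3 * m)%R = (-1) ^+ `|m|%N.
Proof. by rewrite abszM exprM -[_ ^+ absz 3]signr_odd. Qed.

Lemma sign_succ (m : int) : (-1 : ps) ^+ absz (m + 1)%R = - (-1) ^+ `|m|%N.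
Proof.
case: m => l.
  have -> : absz (Posz l + 1)%R = l.+1 by lia.
  by rewrite exprS mulN1r.
have -> : absz (Negz l + 1)%R = l by lia.
by rewrite /= exprS mulN1r opprK.
Qed.

(** The squares (3m)^2 give the first series; (3m + 1)^2 and (3m - 1)^2 give equal contributions by
    m -> -m, whence the factor 2. *)
Lemma phi_dissection : theta (-1) 1 1 = theta (-1) 9 9 - psq * (2 * theta (-1) 15 3).
Proof.
have cc : (-1 : ps) * -1 = 1 by rewrite mulrNN mulr1.
apply: eqm_eq => N.
apply: eqm_trans (eqm_le _ (@triple_product (-1) 1 1 (3 * N).+1 cc isT)) _; first by lia.
apply: eqm_sym; apply: eqm_trans (eqmD (@triple_product (-1) 9 9 N cc isT) (eqmN (eqmM
  (eqm_refl _) (eqmM (eqm_refl _) (@triple_product (-1) 15 3 N cc isT))))) _.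
suff -> : theta_sum (-1) 1 1 (3 * N).+1 = theta_sum (-1) 9 9 N -
   psq * (2 * theta_sum (-1) 15 3 N) by [].
have -> : 2 * theta_sum (-1) 15 3 N = theta_sum (-1) 15 3 N + theta_sum (-1) 3 15 N.
  by rewrite [X in _ = _ + X]theta_sumN; ring.
rewrite theta_sum_block3 /theta_sum -big_split mulr_sumr -sumrB; apply: eq_bigr => k _ /=.
move: (k%:Z - N%:Z) => m.
have -> : theta_exp 1 1 (3 * m) = theta_exp 9 9 m.
  by apply: theta_expP; rewrite theta_expE; ring.
have -> : theta_exp 1 1 (3 * m + 1) = (theta_exp 15 3 m).+1.
  by apply: theta_expP; rewrite doubleS -addn2 PoszD theta_expE; ring.
have -> : theta_exp 1 1 (3 * m - 1) = (theta_exp 3 15 m).+1.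
  by apply: theta_expP; rewrite doubleS -addn2 PoszD theta_expE; ring.
have -> : (-1 : ps) ^+ absz (3 * m - 1)%R = - (-1) ^+ `|m|%N.
  by have := sign_succ (3 * m - 1); rewrite subrK sign_mul3 => ->; rewrite opprK.
rewrite sign_succ sign_mul3 !exprS; ring.
Qed.

Lemma psi_dissection : theta 1 1 0 = 2 * theta 1 6 3 + psq * theta 1 9 0.
Proof.
have cc : (1 : ps) * 1 = 1 by rewrite mulr1.
apply: eqm_eq => N.
apply: eqm_trans (eqm_le _ (@triple_product 1 1 0 (3 * N).+1 cc isT)) _; first by lia.
apply: eqm_sym; apply: eqm_trans (eqmD (eqmM (eqm_refl _) (@triple_product 1 6 3 N cc isT))
  (eqmM (eqm_refl _) (@triple_product 1 9 0 N cc isT))) _.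
suff -> : theta_sum 1 1 0 (3 * N).+1 = 2 * theta_sum 1 6 3 N +
   psq * theta_sum 1 9 0 N by [].
have -> : 2 * theta_sum 1 6 3 N = theta_sum 1 6 3 N + theta_sum 1 3 6 N.
  by rewrite [X in _ = _ + X]theta_sumN; ring.
rewrite theta_sum_block3 /theta_sum -big_split mulr_sumr -big_split; apply: eq_bigr => k _ /=.
move: (k%:Z - N%:Z) => m.
have -> : theta_exp 1 0 (3 * m) = theta_exp 6 3 m.
  by apply: theta_expP; rewrite theta_expE; ring.
have -> : theta_exp 1 0 (3 * m + 1) = (theta_exp 9 0 m).+1.
  by apply: theta_expP; rewrite doubleS -addn2 PoszD theta_expE; ring.
have -> : theta_exp 1 0 (3 * m - 1) = theta_exp 3 6 m.
  by apply: theta_expP; rewrite theta_expE; ring.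
rewrite !expr1n exprS; ring.
Qed.

(** * Three-dissections of phi and psi *)

Lemma psi_theta m : (0 < m)%N -> Eq m * theta 1 m 0 = 2 * Eq (2 * m) ^+ 2.
Proof.
(* With b = 0 the first factor of [qfac 1 m 0] is 1 + q^0, the origin of the 2. *)
move=> m0; rewrite /theta addn0 [X in _ * X * _]qfac_recl // addn0 expr0 mulr1.
rewrite [Eq (2 * m)]EqE ?muln_gt0 // -qfac_plusM // -EqE //; ring.
Qed.

Lemma phi_theta m : (0 < m)%N -> Eq (2 * m) * theta (-1) m m = Eq m ^+ 2.
Proof.
move=> m0; have e : Eq m = qfac (-1) (2 * m) m * Eq (2 * m).
  rewrite !EqE ?muln_gt0 // (@qfac_block 2) // !big_ord_recl big_ord0 mulr1.
  by congr (qfac _ _ _ * qfac _ _ _); rewrite /bump /= ?muln0 ?muln1 ?add0n ?addnn ?mul2n ?muln2.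
by rewrite /theta addnn -mul2n [X in _ = X ^+ 2]e; ring.
Qed.

(** Once all products are refined to residue classes modulo 18, both sides have the same factors. *)
Lemma theta_15_3 : Eq 6 * Eq 9 * theta (-1) 15 3 = Eq 3 * Eq 18 ^+ 2.
Proof.
rewrite /theta /= !EqE // (@qfac_block 3 _ 6) // (@qfac_block 2 _ 9) // (@qfac_block 6 _ 3) //.
by rewrite !big_ord_recl !big_ord0 /=; ring.
Qed.

Lemma theta_6_3 : Eq 3 * Eq 18 * theta 1 6 3 = Eq 6 * Eq 9 ^+ 2.
Proof.
rewrite /theta /= !EqE // (@qfac_block 3 _ 3) // (@qfac_block 3 _ 6) //.
rewrite !big_ord_recl !big_ord0 /=.
rewrite -[qfac (-1) 18 6]/(qfac (-1) (2 * 9) (2 * 3)).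
rewrite -[qfac (-1) 18 12]/(qfac (-1) (2 * 9) (2 * 6)).
by rewrite -!qfac_plusM //; ring.
Qed.

Lemma phi_identity : Eq 1 ^+ 2 * Eq 18 * Eq 6 * Eq 9 =
  Eq 2 * (Eq 9 ^+ 3 * Eq 6 - 2 * psq * Eq 3 * Eq 18 ^+ 3).
Proof.
have h1 := phi_theta (isT : (0 < 1)%N); have h9 := phi_theta (isT : (0 < 9)%N).
have h := theta_15_3; rewrite -h1 phi_dissection.
transitivity (Eq (2 * 1) * (Eq (2 * 9) * theta (-1) 9 9 * Eq 6 * Eq 9 -
  2 * psq * (Eq 6 * Eq 9 * theta (-1) 15 3) * Eq 18)); first by ring.
by rewrite h9 h; ring.
Qed.

Lemma ps_mul2I : injective ( *%R (2 : ps)).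
Proof.
move=> f g e; apply: psP => n.
by have := congr1 (fun h : ps => h n) e; rewrite !ps_natrM; lia.
Qed.

Lemma psi_identity : Eq 2 ^+ 2 * Eq 3 * Eq 18 * Eq 9 =
  Eq 1 * (Eq 6 * Eq 9 ^+ 3 + psq * Eq 3 * Eq 18 ^+ 3).
Proof.
have h1 := psi_theta (isT : (0 < 1)%N); have h9 := psi_theta (isT : (0 < 9)%N).
have h := theta_6_3; apply: ps_mul2I.
transitivity (2 * Eq (2 * 1) ^+ 2 * Eq 3 * Eq 18 * Eq 9); first by rewrite !mulrA.
rewrite -h1 psi_dissection.
transitivity (Eq 1 * (2 * (Eq 3 * Eq 18 * theta 1 6 3) * Eq 9 +
  psq * (Eq 9 * theta 1 9 0) * Eq 3 * Eq 18)); first by ring.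
by rewrite h9 h; ring.
Qed.

(** * Residue classes of exponents modulo 3 *)

Definition homog3 (r : nat) (f : ps) := forall n, (n %% 3)%N != (r %% 3)%N -> f n = 0.

Lemma hom_congr r s f : r = s %[mod 3] -> homog3 r f -> homog3 s f.
Proof. by move=> e h n; rewrite -e; apply: h. Qed.
Lemma homD r f g : homog3 r f -> homog3 r g -> homog3 r (f + g).
Proof. by move=> hf hg n nr; rewrite psE hf ?hg. Qed.
Lemma homN r f : homog3 r f -> homog3 r (- f).
Proof. by move=> hf n nr; rewrite psE hf. Qed.
Lemma homM r s f g : homog3 r f -> homog3 s g -> homog3 (r + s) (f * g).
Proof.
move=> hf hg n nrs; rewrite ps_coefM big1 // => k _.
case: (eqVneq (k %% 3)%N (r %% 3)%N) => e; last by rewrite hf // mul0r.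
rewrite (hg (n - k)%N) ?mulr0 //; apply: contra nrs => /eqP e'.
have -> : n = (k + (n - k))%N by have := ltn_ord k; lia.
by rewrite -modnDm e e' modnDm.
Qed.
Lemma homMm r s t f g : homog3 r f -> homog3 s g -> r + s = t %[mod 3] -> homog3 t (f * g).
Proof. by move=> hf hg e; apply: hom_congr e _; apply: homM. Qed.
Lemma homq k : homog3 k (psq ^+ k).
Proof. by move=> n nk; rewrite psq_exp; case: eqP => // e; move: nk; rewrite e eqxx. Qed.
Lemma hom1 : homog3 0 1.
Proof. by rewrite -(expr0 psq); apply: homq. Qed.
Lemma hom0nat c : homog3 0 c%:R.
Proof. by elim: c => [|c IH]; rewrite -?natr1 //; apply: homD => //; apply: hom1. Qed.
Lemma hom00 r : homog3 r 0. Proof. by []. Qed.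
Lemma homX r f k : homog3 r f -> homog3 (k * r) (f ^+ k).
Proof.
move=> hf; elim: k => [|k IH]; first exact: hom1.
by rewrite exprS mulSn; apply: homM.
Qed.

Definition comp3 (r : nat) (f : ps) : ps := fun n => if (n %% 3 == r)%N then f n else 0.

Lemma hom_comp3 r f : homog3 r (comp3 r f).
Proof. by move=> n nr; rewrite /comp3; case: eqP => // e; move: nr; rewrite -e modn_mod eqxx. Qed.

Lemma comp3_sum f : f = comp3 0 f + comp3 1 f + comp3 2 f.
Proof.
apply: psP => n; rewrite !psE /comp3.
have : (n %% 3 < 3)%N by rewrite ltn_mod.
by case: (n %% 3)%N => [|[|[|r]]] //= _; rewrite ?add0r ?addr0.
Qed.

Lemma comp3_hom r s f : (r < 3)%N -> homog3 s f ->
  comp3 r f = if r == (s %% 3)%N then f else 0.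
Proof.
move=> r3 hf; apply: psP => n; rewrite /comp3.
case: (eqVneq r) => [->|rs]; case: eqP => [e|/eqP e] //; last by rewrite hf ?e.
by rewrite hf.
Qed.

Lemma comp3D r f g : comp3 r (f + g) = comp3 r f + comp3 r g.
Proof. by apply: psP => n; rewrite !psE /comp3; case: ifP; rewrite ?addr0 ?psE. Qed.

(* The product of f(q), f(omega q), f(omega^2 q) over the cube roots of unity,
   written in the components of f so that no root of unity is needed. *)
Definition norm3 (f : ps) : ps :=
  let a := comp3 0 f in let b := comp3 1 f in let c := comp3 2 f in
  a ^+ 3 + b ^+ 3 + c ^+ 3 - 3 * a * b * c.

Lemma norm3E a b c : homog3 0 a -> homog3 1 b -> homog3 2 c ->
  norm3 (a + b + c) = a ^+ 3 + b ^+ 3 + c ^+ 3 - 3 * a * b * c.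
Proof.
move=> ha hb hc; rewrite /norm3 !comp3D.
by do !rewrite (comp3_hom _ ha) ?(comp3_hom _ hb) ?(comp3_hom _ hc) //= ?addr0 ?add0r.
Qed.

(** The components of f g are the cyclic convolution of those of f and g, and a^3 + b^3 + c^3 - 3abc
    is a circulant determinant. *)
Lemma norm3M f g : norm3 (f * g) = norm3 f * norm3 g.
Proof.
rewrite [in LHS](comp3_sum f) [in LHS](comp3_sum g) /norm3.
have hf r := @hom_comp3 r f; have hg r := @hom_comp3 r g.
move: (hf 0%N) (hf 1%N) (hf 2%N) (hg 0%N) (hg 1%N) (hg 2%N).
move: (comp3 0 f) (comp3 1 f) (comp3 2 f) (comp3 0 g) (comp3 1 g) (comp3 2 g).
move=> a b c a' b' c' ha hb hc ha' hb' hc'.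
rewrite -/(norm3 _).
have -> : (a + b + c) * (a' + b' + c') = (a * a' + b * c' + c * b') +
  (a * b' + b * a' + c * c') + (a * c' + b * b' + c * a') by ring.
rewrite norm3E; first by ring.
- exact: homD (homD (homMm ha ha' erefl) (homMm hb hc' erefl)) (homMm hc hb' erefl).
- exact: homD (homD (homMm ha hb' erefl) (homMm hb ha' erefl)) (homMm hc hc' erefl).
- exact: homD (homD (homMm ha hc' erefl) (homMm hb hb' erefl)) (homMm hc ha' erefl).
Qed.

Lemma norm3_hom0 f : homog3 0 f -> norm3 f = f ^+ 3.
Proof.
move=> hf; have := norm3E hf (@hom00 1) (@hom00 2); rewrite !addr0 => ->; ring.
Qed.

Lemma norm3_1 : norm3 1 = 1.
Proof. by rewrite norm3_hom0 ?expr1n //; apply: hom1. Qed.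

Lemma norm3_binom k : (k %% 3 != 0)%N -> norm3 (1 + -1 * psq ^+ k) = 1 + -1 * psq ^+ (3 * k).
Proof.
rewrite !mulN1r mulnC exprM => k0.
have : homog3 1 (- psq ^+ k) \/ homog3 2 (- psq ^+ k).
  have : (k %% 3 < 3)%N by rewrite ltn_mod.
  case e : (k %% 3)%N k0 => [|[|[|r]]] // _ _; [left|right];
    by refine (homN (hom_congr _ (@homq k))); rewrite e.
case=> hk.
  by have := norm3E hom1 hk (@hom00 2); rewrite !addr0 => ->; ring.
by have := norm3E hom1 (@hom00 1) hk; rewrite !addr0 => ->; ring.
Qed.

Lemma norm3_eqm N f g : eqm N f g -> eqm N (norm3 f) (norm3 g).
Proof.
move=> e; have ec r : eqm N (comp3 r f) (comp3 r g).
  by move=> n nN; rewrite /comp3 e.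
have eX (u v : ps) k : eqm N u v -> eqm N (u ^+ k) (v ^+ k).
  by move=> uv; elim: k => // k IH; rewrite !exprS; apply: eqmM.
rewrite /norm3; apply: eqmD; last by apply: eqmN; do ![apply: eqmM => //].
by do ![apply: eqmD => //]; apply: eX.
Qed.

Lemma norm3_iprod F : conv F -> norm3 (iprod F) = iprod (fun k => norm3 (F k)).
Proof.
move=> cF; apply: eqm_eq => N.
apply: eqm_trans (norm3_eqm (iprod_eqm cF (leqnn N))) _.
rewrite (big_morph _ norm3M norm3_1); apply: eqm_sym; apply: iprod_eqm => // k.
by have := norm3_eqm (cF k); rewrite norm3_1.
Qed.

Lemma hom_iprod F : (forall k, homog3 0 (F k)) -> homog3 0 (iprod F).
Proof.
move=> hF n; rewrite /iprod.
suff : homog3 0 (\prod_(k < n.+1) F k) by apply.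
elim/big_rec: _ => [|i f _ hf]; first exact: hom1.
exact: (homMm (hF i) hf erefl).
Qed.

Lemma hom_binom k : homog3 0 (1 + -1 * psq ^+ (3 * k)).
Proof.
apply: homD; first exact: hom1.
by rewrite mulN1r; refine (homN (hom_congr _ (@homq _))); rewrite modnMr.
Qed.

Lemma hom_Eq m : (0 < m)%N -> homog3 0 (Eq (3 * m)).
Proof.
move=> m0; rewrite EqE ?muln_gt0 //; apply: hom_iprod => j.
by rewrite -mulnA -mulnDr; apply: hom_binom.
Qed.

(** Factors 1 - q^(mk) with 3 dividing k are merely cubed and yield E(q^(3m))^3; the others become 1
    - q^(3mk) and yield E(q^(3m)) / E(q^(9m)). *)
Lemma norm3_Eq m : (m %% 3 != 0)%N -> norm3 (Eq m) * Eq (9 * m) = Eq (3 * m) ^+ 4.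
Proof.
move=> m3; have m0 : (0 < m)%N by case: m m3.
have E3 : Eq (3 * m) = qfac (-1) (9 * m) (3 * m) * qfac (-1) (9 * m) (6 * m) * Eq (9 * m).
  rewrite !EqE ?muln_gt0 // (@qfac_block 3) ?muln_gt0 // !big_ord_recl big_ord0 mulr1 mulrA.
  by congr (qfac _ _ _ * qfac _ _ _ * qfac _ _ _);
    rewrite /= -?[bump 0 (bump 0 0)]/2%N -?[bump 0 0]/1%N; lia.
have c := @conv_qfac (-1) m m m0.
have cn : conv (fun k => norm3 (1 + -1 * psq ^+ (m * k + m))).
  by move=> k; have := norm3_eqm (c k); rewrite norm3_1.
rewrite [Eq m]EqE // norm3_iprod // (@iprod_block 3) // !big_ord_recl big_ord0 mulr1.
have e0 : iprod (fun j => norm3 (1 + -1 * psq ^+ (m * (3 * j + 0) + m))) =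
    qfac (-1) (9 * m) (3 * m).
  apply: eq_iprod => j; rewrite norm3_binom; first by congr (1 + -1 * psq ^+ _); nia.
  have -> : (m * (3 * j + 0) + m = m * j * 3 + m)%N by nia.
  by rewrite modnMDl.
have e1 : iprod (fun j => norm3 (1 + -1 * psq ^+ (m * (3 * j + 1) + m))) =
    qfac (-1) (9 * m) (6 * m).
  apply: eq_iprod => j; rewrite norm3_binom; first by congr (1 + -1 * psq ^+ _); nia.
  have -> : (m * (3 * j + 1) + m = m * j * 3 + 2 * m)%N by nia.
  by rewrite modnMDl; lia.
have e2 : iprod (fun j => norm3 (1 + -1 * psq ^+ (m * (3 * j + 2) + m))) = Eq (3 * m) ^+ 3.
  rewrite EqE ?muln_gt0 // /qfac.
  set F := fun j : nat => 1 + -1 * psq ^+ (3 * m * j + 3 * m).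
  have cF : conv F by apply: conv_qfac; rewrite muln_gt0.
  rewrite 2!exprS expr1 -!iprodM //; last exact: convM.
  apply: eq_iprod => j; rewrite -!expr2 -exprS norm3_hom0; last first.
    have -> : (m * (3 * j + 2) + m = 3 * (m * j + m))%N by nia.
    exact: hom_binom.
  by congr ((1 + -1 * psq ^+ _) ^+ 3); nia.
transitivity (qfac (-1) (9 * m) (3 * m) * (qfac (-1) (9 * m) (6 * m) * Eq (3 * m) ^+ 3) *
  Eq (9 * m)); first by rewrite -e0 -e1 -e2.
by rewrite [RHS]exprS [X in _ = X * _]E3; ring.
Qed.

(** The norm of [phi_identity]: its difference has components only in classes 0 and 1, so the norm
    there is a sum of two cubes. This is the relation Y (1 - w^3) = 1 before division. *)
Lemma norm_identity : Eq 3 ^+ 8 * Eq 18 ^+ 4 * Eq 9 =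
  Eq 6 * (Eq 9 ^+ 9 * Eq 6 ^+ 3 - 8 * psq ^+ 3 * Eq 3 ^+ 3 * Eq 18 ^+ 9).
Proof.
have h3 : homog3 0 (Eq 3) := @hom_Eq 1 isT.
have h6 : homog3 0 (Eq 6) := @hom_Eq 2 isT.
have h9 : homog3 0 (Eq 9) := @hom_Eq 3 isT.
have h18 : homog3 0 (Eq 18) := @hom_Eq 6 isT.
have := congr1 norm3 phi_identity; rewrite !norm3M.
rewrite (norm3_hom0 h6) (norm3_hom0 h9) (norm3_hom0 h18).
have -> : norm3 (Eq 9 ^+ 3 * Eq 6 - 2 * psq * Eq 3 * Eq 18 ^+ 3) =
   Eq 9 ^+ 9 * Eq 6 ^+ 3 - 8 * psq ^+ 3 * Eq 3 ^+ 3 * Eq 18 ^+ 9.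
  have ha : homog3 0 (Eq 9 ^+ 3 * Eq 6) := homMm (@homX _ _ 3 h9) h6 erefl.
  have hb : homog3 1 (- (2 * psq * Eq 3 * Eq 18 ^+ 3)).
    apply: homN; refine (homMm (homMm (homMm (@hom0nat 2) (@homq 1) _) h3 _) (@homX _ _ 3 h18) _).
    - exact: (erefl (1 %% 3)%N).
    - exact: (erefl (1 %% 3)%N).
    - by [].
  by have := norm3E ha hb (@hom00 2); rewrite !addr0 => ->; ring.
have n1 := @norm3_Eq 1 isT; have n2 := @norm3_Eq 2 isT.
rewrite -[(3 * 1)%N]/3%N -[(9 * 1)%N]/9%N in n1; rewrite -[(3 * 2)%N]/6%N -[(9 * 2)%N]/18%N in n2.
set R := (_ - _) => e.
have u : (Eq 6 ^+ 3 * Eq 9 ^+ 2) 0%N = 1 by rewrite ps_coef0M !ps_coef0X // Eq0.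
apply: (ps_unit_mulI u).
transitivity ((Eq 3 ^+ 4) ^+ 2 * Eq 18 ^+ 4 * Eq 6 ^+ 3 * Eq 9 ^+ 3); first by ring.
rewrite -n1.
transitivity (norm3 (Eq 1) ^+ 2 * Eq 18 ^+ 3 * Eq 6 ^+ 3 * Eq 9 ^+ 3 * (Eq 18 * Eq 9 ^+ 2)).
  by ring.
transitivity (Eq 6 ^+ 4 * R * Eq 9 ^+ 2); last by ring.
rewrite -n2.
transitivity (norm3 (Eq 2) * R * (Eq 18 * Eq 9 ^+ 2)); last by ring.
by congr (_ * _); rewrite -e expr2.
Qed.

(** * The substitution q -> q^3 and the operator U *)

Definition dil (f : ps) : ps := fun n => if (n %% 3 == 0)%N then f (n %/ 3)%N else 0.

(** For s < 3 this is U(q^-s f), kept inside power series. *)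
Definition sect (s : nat) (f : ps) : ps := fun n => f (3 * n + s)%N.

Lemma sectD s f g : sect s (f + g) = sect s f + sect s g.
Proof. by []. Qed.

Lemma sect_dilM s f g : (s < 3)%N -> sect s (dil f * g) = f * sect s g.
Proof.
move=> s3; apply: psP => n; rewrite /sect !ps_coefM.
rewrite (big_ord_widen (3 * n.+1) (fun k => dil f k * g (3 * n + s - k)%N)); last by lia.
rewrite big_mkcond (sum_block3 _ (fun k => if (k < (3 * n + s).+1)%N
   then dil f k * g (3 * n + s - k)%N else 0)).
apply: eq_bigr => j _; have jn := ltn_ord j.
have -> : dil f (3 * j)%N = f j by rewrite /dil modnMr mulKn.
have -> : dil f (3 * j).+1%N = 0 by rewrite /dil; case: eqP => //; lia.
have -> : dil f (3 * j).+2%N = 0 by rewrite /dil; case: eqP => //; lia.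
rewrite !mul0r !if_same !addr0 ifT; last by lia.
by congr (_ * g _); lia.
Qed.

Lemma hom_dil f : homog3 0 (dil f).
Proof. by move=> n n0; rewrite /dil ifF //; apply/negbTE. Qed.

Lemma sect0_dil f : sect 0 (dil f) = f.
Proof. by apply: psP => n; rewrite /sect /dil addn0 modnMr mulKn. Qed.

Lemma hom0_dil f : homog3 0 f -> f = dil (sect 0 f).
Proof.
move=> hf; apply: psP => n; rewrite /dil /sect addn0; case: eqP => e.
  by congr (f _); lia.
by rewrite hf //; apply/eqP.
Qed.

Lemma sect_hom s r f : (s < 3)%N -> (s != r %% 3)%N -> homog3 r f -> sect s f = 0.
Proof.
move=> s3 sr hf; apply: psP => n; rewrite /sect hf //.
by rewrite mulnC modnMDl modn_small.
Qed.

Lemma sect_qM s f : sect s (psq ^+ s * f) = sect 0 f.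
Proof. by apply: psP => n; rewrite /sect coef_psqM addn0 addnK ifF //; lia. Qed.

Lemma dilM f g : dil (f * g) = dil f * dil g.
Proof.
rewrite [RHS]hom0_dil; last exact: homMm (@hom_dil f) (@hom_dil g) erefl.
by rewrite sect_dilM // sect0_dil.
Qed.

Lemma dil1 : dil 1 = 1.
Proof.
rewrite [RHS](hom0_dil hom1); congr dil; apply: psP => n.
by rewrite /sect !psE addn0 muln_eq0.
Qed.

Lemma dilX f k : dil (f ^+ k) = dil f ^+ k.
Proof. by elim: k => [|k IH]; rewrite ?dil1 // !exprS dilM IH. Qed.

Lemma dil_binom k : dil (1 + -1 * psq ^+ k) = 1 + -1 * psq ^+ (3 * k).
Proof.
rewrite !mulN1r; apply: psP => n; rewrite /dil !psE !psq_exp.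
by case: eqP => e; do 2 case: eqP => //; lia.
Qed.

Lemma dil_eqm N f g : eqm N f g -> eqm N (dil f) (dil g).
Proof. by move=> e n nN; rewrite /dil; case: eqP => // _; apply: e; lia. Qed.

Lemma dil_Eq m : (0 < m)%N -> dil (Eq m) = Eq (3 * m).
Proof.
move=> m0; rewrite !EqE ?muln_gt0 //; apply: eqm_eq => N.
apply: eqm_trans (dil_eqm (iprod_eqm (@conv_qfac (-1) m m m0) (leqnn N))) _.
rewrite (big_morph _ dilM dil1); apply: eqm_sym.
have m0' : (0 < 3 * m)%N by rewrite muln_gt0.
apply: eqm_trans (iprod_eqm (@conv_qfac (-1) (3 * m) (3 * m) m0') (leqnn N)) _.
by apply: eqm_prod => i _; rewrite dil_binom mulnDr mulnA.
Qed.

(** * Parametrisation of X and xi *)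

Definition Yps : ps := dil Xps.
Definition wps : ps := 2 * psq * dil (Eq 1 * Eq 6 ^+ 3 * psinv (Eq 2 * Eq 3 ^+ 3)).
Definition gps : ps := dil (Eq 2 * Eq 3 ^+ 3 * psinv (Eq 1 * Eq 6 ^+ 3)).
(** Because Y (1 - w^3) = 1, this is 1/(1 - w), already sorted by residue class of exponents. *)
Definition zps : ps := Yps * (1 + wps + wps ^+ 2).

Lemma XpsE : Xps * (Eq 1 ^+ 8 * Eq 6 ^+ 4) = Eq 2 ^+ 4 * Eq 3 ^+ 8.
Proof.
rewrite /Xps /psdiv !psexpE !ps_mulE -mulrA [psinv _ * _]mulrC psinvE ?mulr1 //.
by rewrite ps_coef0M !ps_coef0X // Eq0.
Qed.

Lemma XipsE : Xips * (Eq 1 ^+ 4 * Eq 18 ^+ 5) = Eq 2 ^+ 5 * Eq 9 ^+ 4.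
Proof.
rewrite /Xips /psdiv !psexpE !ps_mulE -mulrA [psinv _ * _]mulrC psinvE ?mulr1 //.
by rewrite ps_coef0M !ps_coef0X // Eq0.
Qed.

Lemma YpsE : Yps * (Eq 3 ^+ 8 * Eq 18 ^+ 4) = Eq 6 ^+ 4 * Eq 9 ^+ 8.
Proof. by have := congr1 dil XpsE; rewrite [dil (Xps * _)]dilM -/Yps !(dilM, dilX) !dil_Eq. Qed.

Lemma wpsE : wps * (Eq 6 * Eq 9 ^+ 3) = 2 * psq * (Eq 3 * Eq 18 ^+ 3).
Proof.
have -> : Eq 3 * Eq 18 ^+ 3 = dil (Eq 1 * Eq 6 ^+ 3) by rewrite !(dilM, dilX) !dil_Eq.
have -> : Eq 6 * Eq 9 ^+ 3 = dil (Eq 2 * Eq 3 ^+ 3) by rewrite !(dilM, dilX) !dil_Eq.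
rewrite /wps -mulrA -dilM -[_ * psinv _ * _]mulrA [psinv _ * _]mulrC.
by rewrite psinvE ?mulr1 // ps_coef0M ps_coef0X !Eq0.
Qed.

Lemma gpsE : gps * (Eq 3 * Eq 18 ^+ 3) = Eq 6 * Eq 9 ^+ 3.
Proof.
have -> : Eq 3 * Eq 18 ^+ 3 = dil (Eq 1 * Eq 6 ^+ 3) by rewrite !(dilM, dilX) !dil_Eq.
have -> : Eq 6 * Eq 9 ^+ 3 = dil (Eq 2 * Eq 3 ^+ 3) by rewrite !(dilM, dilX) !dil_Eq.
rewrite -dilM -mulrA [psinv _ * _]mulrC.
by rewrite psinvE ?mulr1 // ps_coef0M ps_coef0X !Eq0.
Qed.

Lemma hom_wps : homog3 1 wps.
Proof. exact: homMm (homMm (@hom0nat 2) (@homq 1) (erefl (1 %% 3)%N)) (@hom_dil _) erefl. Qed.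

Ltac ps_unit := by rewrite ?(ps_coef0M, ps_coef0X) ?Eq0.

Lemma gw : gps * wps = 2 * psq.
Proof.
have u : (Eq 3 * Eq 18 ^+ 3 * (Eq 6 * Eq 9 ^+ 3)) 0%N = 1 by ps_unit.
apply: (ps_unit_mulI u).
transitivity ((gps * (Eq 3 * Eq 18 ^+ 3)) * (wps * (Eq 6 * Eq 9 ^+ 3))); first by ring.
by rewrite gpsE wpsE; ring.
Qed.

Lemma Yw3 : Yps * wps ^+ 3 = Yps - 1.
Proof.
suff : Yps * (1 - wps ^+ 3) = 1 by move=> e; rewrite -e; ring.
have u : (Eq 3 ^+ 8 * Eq 18 ^+ 4 * Eq 9) 0%N = 1 by ps_unit.
apply: (ps_unit_mulI u); rewrite mulr1 {2}norm_identity.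
transitivity (Yps * (Eq 3 ^+ 8 * Eq 18 ^+ 4) * Eq 9 * (1 - wps ^+ 3)); first by ring.
rewrite YpsE.
transitivity (Eq 6 * ((Eq 6 * Eq 9 ^+ 3) ^+ 3 - (wps * (Eq 6 * Eq 9 ^+ 3)) ^+ 3)); first by ring.
by rewrite wpsE; ring.
Qed.

Lemma z1w : zps * (1 - wps) = 1.
Proof.
transitivity (Yps - Yps * wps ^+ 3); first by rewrite /zps; ring.
by rewrite Yw3; ring.
Qed.

Lemma phi_w : Eq 1 ^+ 2 * Eq 18 * Eq 6 * Eq 9 = Eq 2 * (Eq 6 * Eq 9 ^+ 3) * (1 - wps).
Proof.
rewrite phi_identity.
transitivity (Eq 2 * (Eq 6 * Eq 9 ^+ 3 - wps * (Eq 6 * Eq 9 ^+ 3))); last by ring.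
by rewrite wpsE; ring.
Qed.

(** The fourth power of [phi_w] supplies the E(q)^8 in the denominator of X. *)
Lemma XY1w : Xps * Yps * (1 - wps) ^+ 4 = 1.
Proof.
have u : (Eq 6 ^+ 4 * Eq 9 ^+ 12 * Eq 2 ^+ 4 * (Eq 3 ^+ 8 * Eq 18 ^+ 4)) 0%N = 1 by ps_unit.
apply: (ps_unit_mulI u).
transitivity (Xps * (Yps * (Eq 3 ^+ 8 * Eq 18 ^+ 4)) *
  (Eq 2 * (Eq 6 * Eq 9 ^+ 3) * (1 - wps)) ^+ 4); first by ring.
rewrite -phi_w YpsE.
transitivity (Xps * (Eq 1 ^+ 8 * Eq 6 ^+ 4) * (Eq 18 * Eq 9) ^+ 4 * (Eq 6 ^+ 4 * Eq 9 ^+ 8)).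
  by ring.
by rewrite XpsE; ring.
Qed.

Lemma zz3 : zps ^+ 3 = Yps * (3 * zps ^+ 2 - 3 * zps + 1).
Proof.
have h : zps * wps = zps - 1 by rewrite -z1w; ring.
transitivity (zps ^+ 2 * zps); first by ring.
rewrite {2}/zps.
transitivity (Yps * (zps ^+ 2 + zps * (zps * wps) + (zps * wps) ^+ 2)); first by ring.
by rewrite h; ring.
Qed.

(** By [XY1w], X is z^4 / Y, and z^3 / Y is the quadratic factor by [zz3]. *)
Lemma Xz : Xps = zps * (3 * zps ^+ 2 - 3 * zps + 1).
Proof.
have h : zps * wps = zps - 1 by rewrite -z1w; ring.
have h3 : zps ^+ 3 * (1 - wps) ^+ 3 = 1 by rewrite -exprMn z1w expr1n.
transitivity (zps ^+ 3 * (1 - wps) ^+ 3 * Xps * (zps * (1 - wps))).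
  by rewrite h3 z1w mulr1 mul1r.
rewrite {2}/zps.
transitivity (Xps * Yps * (1 - wps) ^+ 4 * (zps * (zps ^+ 2 + zps * (zps * wps) + (zps * wps) ^+ 2))).
  by ring.
by rewrite XY1w h; ring.
Qed.

(** Of the E(q)^4 in the denominator, two powers are absorbed by [phi_w], giving z, and two by the
    square of [psi_identity], giving (g + q)^2. *)
Lemma Xi_z : Xips = (gps + psq) ^+ 2 * zps.
Proof.
suff e : Xips * (1 - wps) = (gps + psq) ^+ 2.
  by rewrite -e -mulrA [_ * zps]mulrC z1w mulr1.
have F2 : Eq 2 ^+ 2 * Eq 3 * Eq 18 * Eq 9 = Eq 1 * (Eq 3 * Eq 18 ^+ 3) * (gps + psq).
  by rewrite psi_identity -gpsE; ring.
have u : (Eq 6 * Eq 9 ^+ 5 * Eq 18 ^+ 7 * Eq 3 ^+ 2 * Eq 1 ^+ 2 * Eq 2) 0%N = 1 by ps_unit.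
apply: (ps_unit_mulI u).
transitivity (Xips * (Eq 2 * (Eq 6 * Eq 9 ^+ 3) * (1 - wps)) * Eq 1 ^+ 2 * Eq 18 ^+ 5 *
  (Eq 3 * Eq 18 * Eq 9) ^+ 2); first by ring.
rewrite -phi_w.
transitivity (Xips * (Eq 1 ^+ 4 * Eq 18 ^+ 5) * Eq 18 * Eq 6 * Eq 9 *
  (Eq 3 * Eq 18 * Eq 9) ^+ 2); first by ring.
rewrite XipsE.
transitivity (Eq 2 * Eq 9 ^+ 4 * (Eq 18 * Eq 6 * Eq 9) *
  (Eq 2 ^+ 2 * Eq 3 * Eq 18 * Eq 9) ^+ 2); first by ring.
by rewrite F2; ring.
Qed.

(** * Values of the two operators at 1, z and z^2 *)

Lemma sect_Y s f : (s < 3)%N -> sect s (Yps * f) = Xps * sect s f.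
Proof. exact: sect_dilM. Qed.

Lemma sect_natM s c f : sect s (c%:R * f) = c%:R * sect s f.
Proof. by apply: psP => n; rewrite /sect ps_natrM [RHS]ps_natrM. Qed.

Lemma sect0_1 : sect 0 1 = 1.
Proof. by rewrite -[X in sect 0 X]dil1 sect0_dil. Qed.

Lemma homY : homog3 0 Yps. Proof. exact: hom_dil. Qed.
Lemma hom_gps : homog3 0 gps. Proof. exact: hom_dil. Qed.
Lemma hom_3Y : homog3 0 (3 * Yps). Proof. exact: homMm (@hom0nat 3) homY erefl. Qed.

Lemma sect0_w a b c : homog3 0 b -> homog3 0 c ->
  sect 0 (a + b * wps + c * wps ^+ 2) = sect 0 a.
Proof.
move=> hb hc; rewrite !sectD (@sect_hom 0 1 (b * wps)) //; last exact: homMm hb hom_wps erefl.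
rewrite (@sect_hom 0 2 (c * wps ^+ 2)) ?addr0 //.
exact: homMm hc (@homX _ _ 2 hom_wps) erefl.
Qed.

Lemma z_expand : zps = Yps * (1 + 1 * wps + 1 * wps ^+ 2).
Proof. by rewrite /zps; ring. Qed.

Lemma z2_expand :
  zps ^+ 2 = Yps * ((3 * Yps - 2) + (3 * Yps - 1) * wps + 3 * Yps * wps ^+ 2).
Proof.
transitivity (Yps * (Yps + 2 * Yps * wps + 3 * Yps * wps ^+ 2 + 2 * (Yps * wps ^+ 3) +
  (Yps * wps ^+ 3) * wps)); first by rewrite /zps; ring.
by rewrite Yw3; ring.
Qed.

Lemma sect0_Ylin c d : sect 0 (c%:R * Yps - d%:R) = c%:R * Xps - d%:R.
Proof.
transitivity (sect 0 (c%:R * (Yps * 1)) - sect 0 (d%:R * 1)).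
  by rewrite !mulr1.
by rewrite !sect_natM sect_Y // sect0_1 !mulr1.
Qed.

Lemma U_z : sect 0 zps = Xps.
Proof. by rewrite z_expand sect_Y // sect0_w ?sect0_1 ?mulr1 //; apply: hom1. Qed.

Lemma U_z2 : sect 0 (zps ^+ 2) = 3 * Xps ^+ 2 - 2 * Xps.
Proof.
rewrite z2_expand sect_Y // sect0_w; first by rewrite sect0_Ylin; ring.
- exact: homD hom_3Y (homN hom1).
- exact: hom_3Y.
Qed.

Definition Wop (f : ps) : ps := sect 2 ((gps + psq) ^+ 2 * f).

Lemma Wop_Y f : Wop (Yps * f) = Xps * Wop f.
Proof. by rewrite /Wop mulrCA sect_Y. Qed.

(* Since [gps * wps = 2 * psq], the part of [(gps + psq)^2 (a + b wps + c wps^2)]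
   with exponents congruent to 2 modulo 3 is [psq^2 (a + 4 b + 4 c)]. *)
Lemma Wop_w a b c : homog3 0 a -> homog3 0 b -> homog3 0 c ->
  Wop (a + b * wps + c * wps ^+ 2) = sect 0 (a + 4 * b + 4 * c).
Proof.
move=> ha hb hc.
have hg2 : homog3 0 (gps ^+ 2) := @homX _ _ 2 hom_gps.
have hq : homog3 1 psq := @homq 1.
have hq2 : homog3 2 (psq ^+ 2) := @homq 2.
have hw2 : homog3 2 (wps ^+ 2) := @homX _ _ 2 hom_wps.
rewrite /Wop; have -> : (gps + psq) ^+ 2 * (a + b * wps + c * wps ^+ 2) =
   (gps ^+ 2 * a + psq ^+ 2 * wps * (b + 4 * c)) +
   (gps * psq * (2 * a) + gps ^+ 2 * wps * b + psq ^+ 2 * wps ^+ 2 * c) +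
   psq ^+ 2 * (a + 4 * b + 4 * c).
  transitivity ((gps ^+ 2 * a + psq ^+ 2 * wps * b + 2 * psq * (gps * wps) * wps * c) +
   (gps * psq * (2 * a) + gps ^+ 2 * wps * b + psq ^+ 2 * wps ^+ 2 * c) +
   (psq ^+ 2 * a + 2 * psq * (gps * wps) * b + (gps * wps) ^+ 2 * c)); first by ring.
  by rewrite gw; ring.
rewrite [LHS]sectD sect_qM [sect 2 (_ + _)]sectD.
rewrite (@sect_hom 2 0 (_ + _)) // ?add0r; last first.
  exact: homD (homMm hg2 ha erefl)
    (homMm (homM hq2 hom_wps) (homD hb (homMm (@hom0nat 4) hc erefl)) erefl).
rewrite (@sect_hom 2 1 (_ + _)) // ?add0r //.
exact: homD (homD (homMm (homM hom_gps hq) (homMm (@hom0nat 2) ha erefl) erefl)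
  (homMm (homM hg2 hom_wps) hb erefl)) (homMm (homM hq2 hw2) hc erefl).
Qed.

Lemma W_1 : Wop 1 = 1.
Proof.
transitivity (Wop (1 + 0 * wps + 0 * wps ^+ 2)); first by congr Wop; ring.
by rewrite Wop_w // ?mulr0 ?addr0 ?sect0_1 //; apply: hom1.
Qed.

Lemma W_z : Wop zps = 9 * Xps.
Proof.
rewrite z_expand Wop_Y Wop_w; try exact: hom1.
have -> : 1 + 4 * 1 + 4 * 1 = 9%:R * 1 :> ps by ring.
by rewrite sect_natM sect0_1; ring.
Qed.

Lemma W_z2 : Wop (zps ^+ 2) = 27 * Xps ^+ 2 - 6 * Xps.
Proof.
rewrite z2_expand Wop_Y Wop_w.
- have -> : 3 * Yps - 2 + 4 * (3 * Yps - 1) + 4 * (3 * Yps) = 27%:R * Yps - 6%:R by ring.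
  by rewrite sect0_Ylin; ring.
- exact: homD hom_3Y (homN (@hom0nat 2)).
- exact: homD hom_3Y (homN hom1).
- exact: hom_3Y.
Qed.

(** The result of eliminating z from X = z D and Y D = z^3. Multiplication by D^3 lets each Y absorb
    one D, which leaves a polynomial identity in z. *)
Lemma X_cubic : Xps ^+ 3 = (30 * Yps - 108 * Yps ^+ 2 + 81 * Yps ^+ 3) * Xps ^+ 2 +
  (- (12 * Yps) + 9 * Yps ^+ 2) * Xps + Yps.
Proof.
set z := zps; set D := 3 * z ^+ 2 - 3 * z + 1.
have hX : Xps = z * D := Xz.
have hY : Yps * D = z ^+ 3 by rewrite /D /z zz3.
have z0 : z 0%N = 1.
  have := congr1 (fun f : ps => f 0%N) z1w; rewrite /= ps_coef0M !psE /=.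
  have -> : wps 0%N = 0 by rewrite /wps !ps_coef0M [psq 0%N]/psq mulr0 mul0r.
  by rewrite subr0 mulr1.
(* As z has constant term 1, that of D is 3 - 3 + 1. *)
have D0 : (D ^+ 3) 0%N = 1.
  apply: ps_coef0X; rewrite /D !psE !ps_natrM !ps_coef0X // z0 /=; lia.
apply: (ps_unit_mulI D0).
transitivity (((30 * (Yps * D) * D ^+ 2 - 108 * (Yps * D) ^+ 2 * D + 81 * (Yps * D) ^+ 3) *
   Xps ^+ 2 + (- (12 * (Yps * D) * D ^+ 2) + 9 * (Yps * D) ^+ 2 * D) * Xps +
   (Yps * D) * D ^+ 2)); last by ring.
by rewrite hY hX /D; ring.
Qed.

(** * The first rows and the recurrence *)

Delimit Scope Z_scope with stdZ.

(** Coefficients are binary integers so that whole rows can be computed by [vm_compute]. *)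
Definition evp (x : ps) (s : seq Z) : ps :=
  foldr (fun c a => (int_of_Z c)%:~R + x * a) 0 s.

Fixpoint padd (s t : seq Z) : seq Z :=
  match s, t with
  | [::], _ => t
  | _, [::] => s
  | c :: s', d :: t' => Z.add c d :: padd s' t'
  end.

Definition pmul (s t : seq Z) : seq Z :=
  foldr (fun c a => padd [seq Z.mul c d | d <- t] (Z0 :: a)) [::] s.

Lemma evp_add x s t : evp x (padd s t) = evp x s + evp x t.
Proof.
elim: s t => [|c s IH] [|d t] /=; rewrite ?add0r ?addr0 // IH.
by rewrite -[Z.add c d]/(c + d) rmorphD /= rmorphD /=; ring.
Qed.

Lemma evp_mul x s t : evp x (pmul s t) = evp x s * evp x t.
Proof.
have sc c u : evp x [seq Z.mul c d | d <- u] = (int_of_Z c)%:~R * evp x u.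
  elim: u => [|d u IH] /=; first by rewrite mulr0.
  by rewrite IH -[Z.mul c d]/(c * d) !rmorphM /=; ring.
elim: s => [|c s IH] /=; first by rewrite mul0r.
by rewrite evp_add sc /= IH; ring.
Qed.

(** The only properties of U and [Wop] that the computation of rows and the recurrence need, so both
    matrices are treated at once. *)
Definition Ylinear (L : ps -> ps) :=
  (forall f g, L (f + g) = L f + L g) /\ (forall f, L (Yps * f) = Xps * L f).

Lemma Ylinear_evp L s f : Ylinear L -> L (evp Yps s * f) = evp Xps s * L f.
Proof.
case=> LD LY.
have L0 : L 0 = 0 by apply: (addrI (L 0)); rewrite -LD !addr0.
have LN g : L (- g) = - L g by apply: (addrI (L g)); rewrite -LD !subrr.
have Ln c g : L (c%:R * g) = c%:R * L g.
  elim: c => [|c IH]; first by rewrite !mul0r.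
  by rewrite -natr1 mulrDl mul1r LD IH; ring.
have Lz (c : int) g : L (c%:~R * g) = c%:~R * L g.
  case: c => c; first by rewrite -pmulrn Ln.
  by rewrite NegzE !mulrNz -pmulrn !mulNr LN Ln.
elim: s => [|c s IH] /=; first by rewrite !mul0r.
by rewrite !mulrDl LD Lz -(mulrA Yps) LY IH -(mulrA Xps).
Qed.

Lemma U_Ylinear : Ylinear (sect 0).
Proof. by split=> // f; rewrite sect_Y. Qed.

Lemma W_Ylinear : Ylinear Wop.
Proof. by split=> [f g|f]; rewrite /Wop ?mulrDr // mulrCA sect_Y. Qed.

(* Multiplication by [Xps] in the basis [1, zps, zps^2] over the powers of [Yps]. *)
Definition Xrows : seq (seq Z * seq Z * seq Z) :=
  [:: ([:: 0; 3], [:: 1; -9], [:: -3; 9]);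
      ([:: 0; -3; 9], [:: 0; 12; -27], [:: 1; -18; 27]);
      ([:: 0; 1; -18; 27], [:: 0; -6; 63; -81], [:: 0; 15; -81; 81])]%stdZ.

Lemma XrowsE i : (i < 3)%N ->
  let '(a, b, c) := nth ([::], [::], [::]) Xrows i in
  zps ^+ i * Xps = evp Yps a * 1 + evp Yps b * zps + evp Yps c * zps ^+ 2.
Proof.
(* Each row is a reduction modulo the cubic relation of z; r is the quotient of that division, given
   explicitly below. *)
have c (p q r : ps) : p = q + (zps ^+ 3 - Yps * (3 * zps ^+ 2 - 3 * zps + 1)) * r -> p = q.
  by rewrite zz3 subrr mul0r addr0.
case: i => [|[|[|i]]] // _; rewrite /evp /= /Pos.to_nat /= ?NegzE Xz.
- by apply: (c _ _ 3); ring.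
- by apply: (c _ _ (3 * zps - 3 + 9 * Yps)); ring.
- by apply: (c _ _ (3 * zps ^+ 2 - 3 * zps + 9 * Yps * zps + 1 - 18 * Yps + 27 * Yps ^+ 2)); ring.
Qed.

Definition lcomb (r v : seq Z * seq Z * seq Z) : seq Z :=
  padd (pmul r.1.1 v.1.1) (padd (pmul r.1.2 v.1.2) (pmul r.2 v.2)).

Definition Xstep (v : seq Z * seq Z * seq Z) :=
  let row i := lcomb (nth ([::], [::], [::]) Xrows i) v in (row 0%N, row 1%N, row 2%N).

Definition zstep (v : seq Z * seq Z * seq Z) :=
  (v.1.2, v.2, lcomb ([:: 0; 1], [:: 0; -3], [:: 0; 3])%stdZ v).

Definition values (L : ps -> ps) f (v : seq Z * seq Z * seq Z) :=
  [/\ L f = evp Xps v.1.1, L (zps * f) = evp Xps v.1.2 &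
      L (zps ^+ 2 * f) = evp Xps v.2].

(** A polynomial in Y leaves L as the same polynomial in X, so the coefficient lists of r act
    directly on those of v. *)
Lemma values_lcomb L f v r g : Ylinear L -> values L f v ->
  g = evp Yps r.1.1 * 1 + evp Yps r.1.2 * zps + evp Yps r.2 * zps ^+ 2 ->
  L (g * f) = evp Xps (lcomb r v).
Proof.
move=> hL [h0 h1 h2] ->; have [LD _] := hL.
rewrite /lcomb !evp_add !evp_mul -h0 -h1 -h2 -!(Ylinear_evp _ _ hL) -!LD.
by congr L; ring.
Qed.

Lemma values_step L f v : Ylinear L -> values L f v -> values L (Xps * f) (Xstep v).
Proof.
move=> hL hv; rewrite /values mulrA [zps ^+ 2 * _]mulrA.
split; apply: (values_lcomb hL hv).
- by have := @XrowsE 0 isT; rewrite expr0 mul1r.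
- by have := @XrowsE 1 isT; rewrite expr1.
- by have := @XrowsE 2 isT.
Qed.

Lemma values_zstep L f v : Ylinear L -> values L f v -> values L (zps * f) (zstep v).
Proof.
move=> hL hv; have [_ h1 h2] := hv; split=> //; first by rewrite mulrA -expr2.
rewrite mulrA -exprSr; apply: (values_lcomb hL hv).
by rewrite zz3 /evp /= /Pos.to_nat /= ?NegzE; ring.
Qed.

Lemma U_values : values (sect 0) 1 ([:: 1], [:: 0; 1], [:: 0; -2; 3])%stdZ.
Proof.
rewrite /values !mulr1 U_z U_z2 sect0_1 /evp /= /Pos.to_nat /= ?NegzE; split; ring.
Qed.

Lemma W_values : values Wop 1 ([:: 1], [:: 0; 9], [:: 0; -6; 27])%stdZ.
Proof.
rewrite /values !mulr1 W_1 W_z W_z2 /evp /= /Pos.to_nat /= ?NegzE; split; ring.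
Qed.

(** The polynomial witness records that c has finite support, so no bound has to be carried through
    the recurrence. *)
Definition rep (c : nat -> int) (f : ps) :=
  exists2 p : {poly int}, (forall j, p`_j = c j) & f = (map_poly intr p).[Xps].

Lemma rep_evp s c f : (forall j, c j = nth 0 [seq int_of_Z x | x <- s] j) ->
  f = evp Xps s -> rep c f.
Proof.
move=> hc ->; exists (Poly [seq int_of_Z x | x <- s]) => [j|]; first by rewrite coef_Poly.
elim: s {hc} => [|x s IH] /=; first by rewrite rmorph0 horner0.
rewrite cons_poly_def rmorphD rmorphM /= map_polyX map_polyC /=.
by rewrite hornerMXaddC -IH mulrC addrC.
Qed.

Lemma rep_step x y z F0 F1 F2 : x 0%N = 0 -> y 0%N = 0 -> z 0%N = 0 ->
  rep x F0 -> rep y F1 -> rep z F2 ->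
  rep (step x y z) ((30 * Xps - 108 * Xps ^+ 2 + 81 * Xps ^+ 3) * F2 +
    (- (12 * Xps) + 9 * Xps ^+ 2) * F1 + Xps * F0).
Proof.
move=> x0 y0 z0 [p hp ->] [r hr ->] [s hs ->].
exists (30 *: ('X^1 * s) - 108 *: ('X^2 * s) + 81 *: ('X^3 * s) - 12 *: ('X^1 * r)
  + 9 *: ('X^2 * r) + 'X^1 * p).
  have C (t : {poly int}) c k j : c 0%N = 0 -> (forall j, t`_j = c j) ->
      ('X^k * t)`_j = shr c j k.
    move=> c0 ht; rewrite coefXnM /shr ht.
    (* At j = k, [shr] returns 0 while the coefficient is c 0; they agree because column 0
       vanishes. *)
    by case: ltngtP => // ->; rewrite subnn c0.
  move=> j; rewrite !(coefD, coefN, coefZ) !(C _ _ _ _ x0 hp, C _ _ _ _ y0 hr, C _ _ _ _ z0 hs).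
  rewrite /step; case: eqP => // ->; rewrite /shr /=; ring.
move: Xps => X.
have H c k (t : {poly int}) : (map_poly intr (c *: ('X^k * t))).[X] =
    c%:~R * (X ^+ k * (map_poly intr t).[X]).
  by rewrite map_polyZ rmorphM /= map_polyXn hornerZ hornerM hornerXn.
rewrite -['X^1 * p]scale1r !(rmorphD, rmorphN) /= !(hornerD, hornerN) !H; ring.
Qed.

Lemma L_cubic L h : Ylinear L -> L (Xps ^+ 3 * h) =
  (30 * Xps - 108 * Xps ^+ 2 + 81 * Xps ^+ 3) * L (Xps ^+ 2 * h) +
    (- (12 * Xps) + 9 * Xps ^+ 2) * L (Xps * h) + Xps * L h.
Proof.
move=> hL; have [LD LY] := hL.
have e2 x : 30 * x - 108 * x ^+ 2 + 81 * x ^+ 3 = evp x [:: 0; 30; -108; 81]%stdZ.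
  by rewrite /evp /= /Pos.to_nat /= ?NegzE; ring.
have e1 x : - (12 * x) + 9 * x ^+ 2 = evp x [:: 0; -12; 9]%stdZ.
  by rewrite /evp /= /Pos.to_nat /= ?NegzE; ring.
by rewrite [in LHS]X_cubic !e2 !e1 -!(Ylinear_evp _ _ hL) -LY -!LD; congr L; ring.
Qed.

Lemma rep_recmat L h r1 r2 r3 k : Ylinear L ->
  r1 0%N = 0 -> r2 0%N = 0 -> r3 0%N = 0 ->
  rep r1 (L h) -> rep r2 (L (Xps * h)) -> rep r3 (L (Xps ^+ 2 * h)) ->
  recmat r1 r2 r3 k.+1 0%N = 0 /\ rep (recmat r1 r2 r3 k.+1) (L (Xps ^+ k * h)).
Proof.
move=> hL z1 z2 z3 h1 h2 h3.
(* The induction needs all three rows held by [trip], of indices k + 1, k + 2 and k + 3. *)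
suff : let '(x, y, z) := trip r1 r2 r3 k in
  [/\ x 0%N = 0, y 0%N = 0 & z 0%N = 0] /\
  [/\ rep x (L (Xps ^+ k * h)), rep y (L (Xps * (Xps ^+ k * h))) &
      rep z (L (Xps ^+ 2 * (Xps ^+ k * h)))].
  rewrite /recmat /=; case: (trip r1 r2 r3 k) => [[x y] z] [[x0 _ _] [hx _ _]].
  by split.
elim: k => [|k]; first by rewrite /= expr0 mul1r.
rewrite /=; case: (trip r1 r2 r3 k) => [[x y] z] [[x0 y0 z0] [hx hy hz]].
split; first by split.
rewrite exprS -(mulrA Xps); split=> //; first by rewrite mulrA -expr2.
rewrite mulrA -exprSr L_cubic //; exact: rep_step.
Qed.

Lemma rep_Xcomb c f : c 0%N = 0 -> rep c f ->
  (exists N : nat, forall j, (N <= j)%N -> c j = 0) /\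
  forall N : nat, (forall j, (N <= j)%N -> c j = 0) -> f = Xcomb c N.
Proof.
move=> c0 [p hp ->]; split.
  by exists (size p) => j sj; rewrite -hp nth_default.
move=> N hN; have sN : (size (map_poly intr p : {poly ps}) <= N)%N.
  apply: leq_trans (size_poly _ _) _; apply/leq_sizeP => j Nj; rewrite hp; exact: hN.
rewrite (horner_coef_wide _ sN); apply: psP => n; rewrite ps_sumE /Xcomb.
case: N {hN sN} => [|N]; first by rewrite big_ord0 big_geq.
rewrite big_ord_recl coef_map /= hp c0 mulr0z mul0r psE add0r big_add1 big_mkord.
by apply: eq_bigr => i _; rewrite coef_map /= hp ps_intrM psexpE ps_mulE -exprS.
Qed.

Lemma znE b : zn b = int_of_Z (Z.of_N b).
Proof. by rewrite /zn; lia. Qed.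

Lemma oppznE b : - zn b = int_of_Z (Z.opp (Z.of_N b)).
Proof. by rewrite /zn; lia. Qed.

(* Rewriting with these two lemmas would compare distinct literals in unary. *)
Ltac zn_row := repeat match goal with
  | |- zn ?b :: _ = _ => apply: (congr2 cons (znE b))
  | |- - zn ?b :: _ = _ => apply: (congr2 cons (oppznE b))
  end; reflexivity.

Lemma rep_row s t f : t = [seq int_of_Z x | x <- s] -> f = evp Xps (Z0 :: s) ->
  rep (row_of t) f.
Proof. by move=> -> e; apply: (@rep_evp (Z0 :: s) _ _ _ e). Qed.

Lemma U_rows k : amat k.+1 0%N = 0 /\ rep (amat k.+1) (sect 0 (Xps ^+ k * Xps)).
Proof.
have hL := U_Ylinear; have v0 := U_values.
have := values_step hL v0; rewrite [Xps * 1]mulr1 => v1.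
have v2 := values_step hL v1; have := values_step hL v2; rewrite (mulrA Xps Xps) -expr2 => v3.
case: v1 v2 v3 => r1 _ _ [r2 _ _] [r3 _ _].
apply: (rep_recmat _ hL (erefl 0) (erefl 0) (erefl 0)).
- apply: (@rep_row [:: 10; -36; 27]%stdZ); first by zn_row.
  by rewrite r1; congr evp; vm_compute.
- apply: (@rep_row [:: -8; 306; -2160; 5508; -5832; 2187]%stdZ); first by zn_row.
  by rewrite r2; congr evp; vm_compute.
- apply: (@rep_row [:: 1; -360; 10566; -99144; 423549; -944784; 1141614; -708588; 177147]%stdZ); first by zn_row.
  by rewrite r3; congr evp; vm_compute.
Qed.

(** The seed is X z rather than X, since q^2 xi contributes the factor z besides (g + q)^2; hence
    the initial [values_zstep]. *)
Lemma W_rows k : bmat k.+1 0%N = 0 /\ rep (bmat k.+1) (Wop (Xps ^+ k * (Xps * zps))).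
Proof.
have hL := W_Ylinear; have := values_zstep hL W_values; rewrite mulr1 => v0.
have v1 := values_step hL v0.
have v2 := values_step hL v1; have := values_step hL v2; rewrite (mulrA Xps Xps) -expr2 => v3.
case: v1 v2 v3 => r1 _ _ [r2 _ _] [r3 _ _].
apply: (rep_recmat _ hL (erefl 0) (erefl 0) (erefl 0)).
- apply: (@rep_row [:: -9; 252; -891; 729]%stdZ); first by zn_row.
  by rewrite r1; congr evp; vm_compute.
- apply: (@rep_row [:: 1; -378; 8613; -54675; 138510; -150903; 59049]%stdZ); first by zn_row.
  by rewrite r2; congr evp; vm_compute.
- apply: (@rep_row [:: 0; 147; -14553; 312255; -2617839; 10764414; -23914845; 29288304; -18600435; 4782969]%stdZ); first by zn_row.
  by rewrite r3; congr evp; vm_compute.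
Qed.

Theorem theorem2p5 : forall i : nat, (1 <= i)%N ->
  ((exists N : nat, forall j, (N <= j)%N -> amat i j = 0) /\
   forall N : nat, (forall j, (N <= j)%N -> amat i j = 0) ->
     forall n : int,
       Ucoef (lofps (psexp Xps i)) n = lcoef (lofps (Xcomb (amat i) N)) n) /\
  ((exists N : nat, forall j, (N <= j)%N -> bmat i j = 0) /\
   forall N : nat, (forall j, (N <= j)%N -> bmat i j = 0) ->
     forall n : int,
       Ucoef (lmul xi (lofps (psexp Xps i))) n = lcoef (lofps (Xcomb (bmat i) N)) n).
Proof.
case=> // i _.
have [a0 ha] := U_rows i; have [b0 hb] := W_rows i.
have [ea fa] := rep_Xcomb a0 ha; have [eb fb] := rep_Xcomb b0 hb.
split; split=> // N hN n.
- rewrite psexpE exprSr /Ucoef /lcoef /= -(fa N hN) /sect.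
  case: n => n; last by [].
  have -> : 0 <= 3 * n%:Z by lia.
  by congr (_ _); lia.
- rewrite psexpE /Ucoef /lcoef /= -(fb N hN) ps_mulE Xi_z.
  have -> : (gps + psq) ^+ 2 * zps * Xps ^+ i.+1 =
    (gps + psq) ^+ 2 * (Xps ^+ i * (Xps * zps)) by rewrite [Xps ^+ i.+1]exprS; ring.
  rewrite /Wop /sect.
  (* Relative to the leading exponent -2, the coefficient at 3n has index 3n + 2, the one read by
     [sect 2]; for n < 0 one has 3n <= -3 < -2 and both sides vanish. *)
  case: n => n.
    have -> : -2 + 0 <= 3 * n%:Z by lia.
    by congr (_ _); lia.
  by have -> : (-2 + 0 <= 3 * Negz n) = false by lia.
Qed.
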